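(* Let $\{N^f_\mu(t)\}_{t\ge 0}$, $N^f_\mu(t)=N(D^f(G_\mu(t)))$, be the geometric subordinated Poisson process with Poisson intensity $\lambda>0$ and geometric parameter $\mu>0$, and assume that $\mathbb{E}[(N^f(t))^r]<\infty$ for all $r>0$ (and all $t$). Then: (i) $\mathbb{E}[N^f_\mu(t)]=\lambda\mu t\,\mathbb{E}[D^f(1)]$; (ii) $\mathrm{Var}[N^f_\mu(t)]=\lambda\mu t\left(\lambda\,\mathbb{E}[(D^f(1))^2]+\mathbb{E}[D^f(1)]\right)+\mu^2\lambda^2t^2\,(\mathbb{E}[D^f(1)])^2$; (iii) for $0<s<t$, $\mathrm{Cov}[N^f_\mu(t),N^f_\mu(s)]=\lambda\mu s\left(\lambda\,\mathbb{E}[(D^f(1))^2]+\mathbb{E}[D^f(1)]\right)+\mu^2\lambda^2 s t\,(\mathbb{E}[D^f(1)])^2$.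
   Context: $\{D^f(t)\}_{t\ge0}$ is a Lévy subordinator (non-decreasing Lévy process) with Laplace transform $\mathbb{E}[e^{-sD^f(t)}]=e^{-tf(s)}$, where $f(s)=bs+\int_0^\infty(1-e^{-sx})\,\nu(dx)$, $b\ge0$, is a Bernstein function, and $\nu$ is a Lévy measure on the positive half-line with $\int_0^\infty (x\wedge 1)\,\nu(dx)<\infty$ and infinite total mass. $\{N(t)\}_{t\ge0}$ is a homogeneous Poisson process with intensity $\lambda>0$, independent of $D^f$. The subordinated Poisson process is $N^f(t)=N(D^f(t))$. The geometric counting process $\{G_\mu(t)\}_{t\ge0}$ with parameter $\mu>0$ is the mixed Poisson process whose random rate is exponentially distributed with mean $\mu$ (conditionally on the rate $\Lambda$, it is a Poisson process of intensity $\Lambda$); it satisfies $G_\mu(0)=0$, has stationary increments, and $\mathbb{P}[G_\mu(t)=k]=\frac{1}{1+\mu t}\left(\frac{\mu t}{1+\mu t}\right)^k$ for $k=0,1,2,\dots$. The geometric subordinated Poisson process is $N^f_\mu(t):=N^f(G_\mu(t))$, $t\ge 0$, where $G_\mu$ is independent of $N^f$. *)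

(* Defs.v *)
From HB Require Import structures.
From mathcomp Require Import all_boot all_order all_algebra.
From mathcomp Require Import all_classical all_reals all_analysis.

Set Implicit Arguments.
Unset Strict Implicit.
Unset Printing Implicit Defensive.

Import Order.TTheory GRing.Theory Num.Theory.
Import numFieldNormedType.Exports.

Local Open Scope classical_set_scope.
Local Open Scope ring_scope.

(* A stochastic process is a family [X : R -> {RV P >-> R}]; only the times
   [t >= 0] are meaningful, and no condition below constrains negative ones.
   Path properties are required almost surely. *)

Definition cadlag {R : realType} (x : R -> R) : Prop :=
  forall t : R, 0 <= t ->
    x s @[s --> t^'+] --> x t /\ (0 < t -> cvg (x s @[s --> t^'-])).

Definition independent_increments d (T : measurableType d) (R : realType)
    (P : probability T R) (X : R -> {RV P >-> R}) : Prop :=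
  forall (n : nat) (t : nat -> R) (B : nat -> set R),
    0 <= t 0%N -> (forall i, t i <= t i.+1) -> (forall i, measurable (B i)) ->
    P (\bigcap_(i < n) [set w | B i (X (t i.+1) w - X (t i) w)]) =
    (\prod_(i < n) P [set w | B i (X (t i.+1) w - X (t i) w)%R])%E.

Definition stationary_increments d (T : measurableType d) (R : realType)
    (P : probability T R) (X : R -> {RV P >-> R}) : Prop :=
  forall (t h : R) (B : set R), 0 <= t -> 0 <= h -> measurable B ->
    P [set w | B (X (t + h) w - X t w)] = P [set w | B (X h w - X 0 w)].

(* Stochastic continuity follows from these clauses. *)
Definition levy_process d (T : measurableType d) (R : realType)
    (P : probability T R) (X : R -> {RV P >-> R}) : Prop :=
  [/\ {ae P, forall w, X 0 w = 0},
      independent_increments X,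
      stationary_increments X
    & {ae P, forall w, cadlag (X ^~ w)}].

(* Only used at positive rates: [poisson_pmf] takes the value 1 at rate 0. *)
Definition poisson_process d (T : measurableType d) (R : realType)
    (P : probability T R) (lambda : R) (N : R -> {RV P >-> R}) : Prop :=
  levy_process N /\
  forall (s t : R) (k : nat), 0 <= s -> s < t ->
    P [set w | N t w - N s w = k%:R] = (poisson_pmf (lambda * (t - s)) k)%:E.

Definition infinite_levy_measure (R : realType)
    (nu : {measure set R -> \bar R}) : Prop :=
  [/\ nu [set x | x <= 0] = 0%E,
      (\int[nu]_(x in [set x : R | (0 < x)%R]) (Num.min x 1)%:E < +oo)%E
    & nu [set x | 0 < x] = +oo%E].

Definition bernstein_fun (R : realType) (b : R)
    (nu : {measure set R -> \bar R}) (s : R) : R :=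
  b * s + \int[nu]_(x in [set x : R | (0 < x)%R]) (1 - expR (- (s * x))).

Definition subordinator d (T : measurableType d) (R : realType)
    (P : probability T R) (f : R -> R) (D : R -> {RV P >-> R}) : Prop :=
  [/\ levy_process D,
      {ae P, forall w, forall s t : R, 0 <= s -> s <= t -> D s w <= D t w}
    & forall s t : R, 0 <= s -> 0 <= t ->
        ('E_P[fun w => expR (- (s * D t w))] = (expR (- (t * f s)))%:E)%E].

(* Conditionally on [L], the process [G] is Poisson with intensity [L]: the
   conditional law given [L] of the increments of [G] is written as a
   disintegration over the events [L @^-1` B]. *)
Definition conditionally_poisson d (T : measurableType d) (R : realType)
    (P : probability T R) (L : {RV P >-> R}) (G : R -> {RV P >-> R}) : Prop :=
  [/\ {ae P, forall w, G 0 w = 0},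
      {ae P, forall w, cadlag (G ^~ w)}
    & forall (n : nat) (t : nat -> R) (k : nat -> nat) (B : set R),
        0 <= t 0%N -> (forall i, t i < t i.+1) -> measurable B ->
        P (L @^-1` B `&`
           \bigcap_(i < n) [set w | G (t i.+1) w - G (t i) w = (k i)%:R]) =
        (\int[P]_(w in L @^-1` B)
           (\prod_(i < n) poisson_pmf (L w * (t i.+1 - t i)) (k i))%R%:E)%E].

(* The exponential law with mean [mu] has rate [mu^-1]. *)
Definition geometric_counting_process d (T : measurableType d) (R : realType)
    (P : probability T R) (mu : R) (G : R -> {RV P >-> R}) : Prop :=
  exists L : {RV P >-> R},
    (forall B : set R, measurable B ->
       distribution P L B = exponential_prob mu^-1 B) /\
    conditionally_poisson L G.

Definition sigma_process d (T : measurableType d) (R : realType)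
    (P : probability T R) (X : R -> {RV P >-> R}) : set (set T) :=
  <<s [set A | exists (t : R) (B : set R),
         [/\ 0 <= t, measurable B & A = X t @^-1` B]] >>.

Definition independent_processes d (T : measurableType d) (R : realType)
    (P : probability T R) (X Y : R -> {RV P >-> R}) : Prop :=
  forall A B, sigma_process X A -> sigma_process Y B ->
    P (A `&` B) = (P A * P B)%E.

(* [Z] is [X] evaluated at the random time [Y t]. As path regularity only holds
   almost surely, [w |-> X (Y t w) w] need only be measurable up to a null set,
   so [Z t] is any random variable almost surely equal to it. *)
Definition time_change d (T : measurableType d) (R : realType)
    (P : probability T R) (X Y Z : R -> {RV P >-> R}) : Prop :=
  forall t : R, 0 <= t -> {ae P, forall w, Z t w = X (Y t w) w}.

(* Main.v *)
(* A geometric counting process has a mixed Poisson law, like the Poisson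
   process itself, so its increments have second moments that are explicit in
   the moments of the mixing rate, and E[G_s G_t] follows by polarization.
   The Levy property gives E[D_j D_k] at integer times in the same way.
   Composing with an independent random time that takes countably many values
   only requires summing over these values. The subordinator takes
   uncountably many values, but its values can be rounded down or up to a grid
   of mesh c: as the paths of N are monotone, this bounds the moments of
   N(D_t) on both sides by quantities that differ by O(c). The lower bound with
   c = 1 also turns the moment hypothesis on N(D_1) into E[D_1^2] < oo. *)

Require Import Defs.
From HB Require Import structures.
From mathcomp Require Import all_boot all_order all_algebra.
From mathcomp Require Import all_classical all_reals all_analysis.
From mathcomp Require Import measurable_realfun ring lra.

Set Implicit Arguments.
Unset Strict Implicit.
Unset Printing Implicit Defensive.

Import Order.TTheory GRing.Theory Num.Theory.
Import numFieldNormedType.Exports.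

Local Open Scope classical_set_scope.
Local Open Scope ring_scope.

(** * Expectations at an independent random index *)

(** Product moments keep one shape throughout: for the Poisson process, for the subordinator at
    integer times and for their composition, the mean of [X_s * X_t] is
    [a * min s t + c ^ 2 * s * t], where [a] and [c] are the variance and the mean at time 1. For
    the geometric process the coefficient of [s * t] is the second moment [2 * mu ^ 2] of the
    exponential rate instead of the squared mean; this surplus is the source of the last term of the
    covariance. Conditioning on [D] by Fubini meets an obstacle: path regularity holds only almost
    surely, so joint measurability of [N] in time and outcome is not at hand. With countably many
    times the difficulty disappears. Expectations are taken of absolute values: the identities then
    make sense in the extended reals before any integrability is known, and almost sure
    nonnegativity removes the absolute values at the end. *)

Section expectation_complements.
Context d (T : measurableType d) (R : realType) (P : probability T R).
Local Open Scope ereal_scope.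

Lemma expectationE (X : T -> R) : 'E_P[X] = \int[P]_w (X w)%:E.
Proof. by rewrite unlock. Qed.

Lemma ae_eq_expectation (X Y : T -> R) :
  measurable_fun [set: T] X -> measurable_fun [set: T] Y ->
  {ae P, forall w, X w = Y w} -> 'E_P[X] = 'E_P[Y].
Proof.
move=> mX mY XY; rewrite !expectationE; apply: ae_eq_integral => //.
- exact/measurable_EFinP.
- exact/measurable_EFinP.
- by apply: filterS XY => w ->.
Qed.

Lemma ae_eq_probability (A B : set T) : measurable A -> measurable B ->
  {ae P, forall w, A w <-> B w} -> P A = P B.
Proof.
move=> mA mB AB.
apply: etrans (esym (expectation_indic P mA)) _.
apply: etrans _ (expectation_indic P mB).
apply: ae_eq_expectation; [exact: measurable_indic|exact: measurable_indic|].
apply: filterS AB => w AB; rewrite !indicE; congr (_%:R); congr nat_of_bool.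
by apply/idP/idP; rewrite !inE => /AB.
Qed.

(** Independence identifies the joint law with the product of the marginals, and Tonelli factors the
    integral. The absolute values make the identity valid in the extended reals, infinite
    expectations included. *)
Lemma expectation_norm_mul (X Y : T -> R) :
  measurable_fun [set: T] X -> measurable_fun [set: T] Y ->
  (forall A B, measurable A -> measurable B ->
     P (X @^-1` A `&` Y @^-1` B) = P (X @^-1` A) * P (Y @^-1` B)) ->
  'E_P[fun w => `|X w * Y w|%R] =
  'E_P[fun w => `|X w|%R] * 'E_P[fun w => `|Y w|%R].
Proof.
move=> mX mY XY.
pose X' : {RV P >-> R} := mfun_Sub (mem_set mX).
pose Y' : {RV P >-> R} := mfun_Sub (mem_set mY).
pose Z w := (X' w, Y' w).
have mZ : measurable_fun [set: T] Z by exact: measurable_fun_pair.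
pose Z' : {RV P >-> (R * R)%type} :=
  mfun_Sub (mem_set mZ).
have mf : measurable_fun [set: R * R]
    (fun z => (`|z.1 * z.2|%R)%:E).
  apply/measurable_EFinP; apply: measurableT_comp => //.
  exact: measurable_funM.
have -> : 'E_P[fun w => `|X w * Y w|%R] =
    \int[distribution P Z']_z (`|z.1 * z.2|%R)%:E.
  by rewrite ge0_integral_distribution// expectationE.
rewrite (eq_measure_integral (distribution P X' \x distribution P Y')); last first.
  by move=> A mA _; apply/esym; exact: product_measure_unique.
have mn : measurable_fun [set: R] (fun x => (`|x|%R)%:E).
  by apply/measurable_EFinP; exact: normr_measurable.
rewrite fubini_tonelli1//=.
under eq_integral => x _.
  rewrite /fubini_F/=.
  under eq_integral => y _ do rewrite normrM EFinM.
  rewrite ge0_integralZl// ge0_integral_distribution//=.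
  over.
rewrite ge0_integralZr//=; last by apply: integral_ge0.
by rewrite ge0_integral_distribution//= !expectationE.
Qed.

End expectation_complements.

Section random_index.
Context d (T : measurableType d) (R : realType) (P : probability T R).
Context (I : countType) (K : T -> I).
Hypothesis mK : forall i, measurable (K @^-1` [set i]).

Lemma measurable_random_index (X : I -> T -> R) :
  (forall i, measurable_fun [set: T] (X i)) ->
  measurable_fun [set: T] (fun w => X (K w) w).
Proof.
move=> mX _ B mB; rewrite setTI.
(* [pickle_inv] enumerates the countable type [I] along the naturals; numbers that code no index
   contribute the empty set. *)
have -> : (fun w => X (K w) w) @^-1` B =
    \bigcup_(n in [set: nat]) (if @pickle_inv I n is Some i then
      K @^-1` [set i] `&` X i @^-1` B else set0).
  apply/seteqP; split => [w /= XB|w [n _]].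
    by exists (pickle (K w)) => //; rewrite pickleK_inv.
  by case: pickle_inv => // i [/= <-].
apply: bigcup_measurable => n _; case: pickle_inv => // i.
by apply: measurableI => //; rewrite -[_ @^-1` _]setTI; exact: mX.
Qed.

Local Open Scope ereal_scope.

Lemma expectation_random_index (X : I -> T -> R) :
  (forall i, measurable_fun [set: T] (X i)) ->
  (forall i w, 0 <= X i w)%R ->
  'E_P[fun w => X (K w) w] =
  \sum_(n <oo) if @pickle_inv I n is Some i then
    \int[P]_(w in K @^-1` [set i]) (X i w)%:E else 0.
Proof.
move=> mX X0; rewrite expectationE.
pose A n := if @pickle_inv I n is Some i then K @^-1` [set i] else set0.
have AT : [set: T] = \bigcup_n A n.
  apply/seteqP; split => // w _.
  by exists (pickle (K w)) => //; rewrite /A pickleK_inv.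
rewrite AT ge0_integral_bigcup//; first last.
- apply/trivIsetP => m n _ _ mn; rewrite /A.
  case Em : pickle_inv (@pickle_invK I m) => [i|] /=; last by rewrite set0I.
  case En : pickle_inv (@pickle_invK I n) => [j|] /=; last by rewrite setI0.
  move=> jn im; rewrite -subset0 => w [/= Ki Kj].
  by move/eqP : mn; apply; rewrite -im -jn -Ki Kj.
- by move=> w _; rewrite lee_fin.
- by rewrite -AT; apply/measurable_EFinP; exact: measurable_random_index.
- by move=> n; rewrite /A; case: pickle_inv.
apply: eq_eseriesr => n _; rewrite /A; case: pickle_inv => [i|]; last first.
  by rewrite integral_set0.
by apply: eq_integral => w /set_mem /= ->.
Qed.

(** Law of total expectation: on the event [K = i], independence turns the integral of [X i] into
    the probability of the event times [h i]. *)
Lemma expectation_indep_random_index (X : I -> T -> R) (h : I -> R) :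
  (forall i, measurable_fun [set: T] (X i)) ->
  (forall i w, 0 <= X i w)%R ->
  (forall i B, measurable B ->
     P (K @^-1` [set i] `&` X i @^-1` B) =
     P (K @^-1` [set i]) * P (X i @^-1` B)) ->
  (forall i, 'E_P[X i] = (h i)%:E) ->
  'E_P[fun w => X (K w) w] = 'E_P[fun w => h (K w)].
Proof.
move=> mX X0 KX Xh.
have h0 i : (0 <= h i)%R by rewrite -lee_fin -Xh expectation_ge0.
rewrite expectation_random_index// (expectation_random_index (X := fun i _ => h i))//.
apply: eq_eseriesr => n _; case: pickle_inv => // i.
rewrite integral_cst//=.
set A := K @^-1` [set i].
have -> : \int[P]_(w in A) (X i w)%:E = 'E_P[fun w => `|\1_A w * X i w|%R].
  rewrite expectationE integral_mkcond; apply: eq_integral => w _.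
  rewrite patchE indicE; case: ifPn => _; last by rewrite mul0r normr0.
  by rewrite mul1r ger0_norm.
rewrite expectation_norm_mul; [|by apply: measurable_indic; exact: mK|by []|].
  rewrite (_ : (fun w => _) = (\1_A : T -> R)); last first.
    by apply/funext => w; rewrite ger0_norm.
  rewrite (_ : (fun w => _) = X i); last first.
    by apply/funext => w; rewrite ger0_norm.
  rewrite Xh expectation_indic; first by rewrite muleC.
  exact: mK.
(* A preimage under an indicator is the whole space, [A], its complement or the empty set; the
   complement is the case that needs a computation. *)
move=> B C mB mC; rewrite preimage_indic.
have mX' : measurable (X i @^-1` C) by rewrite -[_ @^-1` _]setTI; exact: mX.
have KXA : P (A `&` X i @^-1` C) = P A * P (X i @^-1` C) by exact: KX.
case: ifPn => _; case: ifPn => _ //.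
- by rewrite setTI probability_setT mul1e.
- rewrite setIC -setDE measureD//; [|exact: mK|by rewrite -ge0_fin_numE// fin_num_measure].
  rewrite [X in _ - X](_ : _ = P A * P (X i @^-1` C)); last by rewrite setIC.
  rewrite probability_setC; last exact: mK.
  rewrite muleBl ?mul1e// ?fin_num_measure//.
- by rewrite set0I measure0 mul0e.
Qed.

End random_index.

(** [Num.truncn] sends negative reals to 0, so the fibre over 0 is the whole half-line below 1. *)
Lemma measurable_truncn (R : realType) (n : nat) :
  measurable (@Num.truncn R @^-1` [set n]).
Proof.
have -> : @Num.truncn R @^-1` [set n] =
    `]-oo, n.+1%:R[ `\` (if n is m.+1 then `]-oo, m.+1%:R[ else set0).
  apply/seteqP; split => x /=.
    move=> <-; split; first by rewrite in_itv/= truncnS_gt.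
    case E : (Num.truncn x) => [|m]//=; rewrite in_itv/=; apply/negP.
    by rewrite -leNgt -truncn_gt_nat E.
  rewrite in_itv/= -truncn_le_nat => -[xn nx].
  apply/eqP; rewrite eqn_leq xn/=; case: n xn nx => // m _ /=.
  by rewrite in_itv/= => /negP; rewrite -leNgt -truncn_gt_nat.
by apply: measurableD => //; case: n.
Qed.

(** * Independent processes evaluated at discretized random times *)

Section independent_processes_theory.
Context d (T : measurableType d) (R : realType) (P : probability T R).
Implicit Types X Y : R -> {RV P >-> R}.

Lemma independent_processesC X Y :
  independent_processes X Y -> independent_processes Y X.
Proof. by move=> XY A B YA XB; rewrite setIC XY// muleC. Qed.

(** Extends the generators, which involve one time, to events that involve two. On
    [g_sigma_algebraType G] each coordinate is measurable by construction, so the claim reduces to a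
    composition. *)
Lemma sigma_process_pair X (s t : R) (g : R * R -> R) (B : set R) :
  0 <= s -> 0 <= t -> measurable_fun [set: R * R] g -> measurable B ->
  sigma_process X ((fun w => g (X s w, X t w)) @^-1` B).
Proof.
move=> s0 t0 mg mB.
pose G := [set A | exists (t : R) (B : set R),
  [/\ 0 <= t, measurable B & A = X t @^-1` B]].
have mX u : 0 <= u ->
    measurable_fun [set: g_sigma_algebraType G] (X u : _ -> R).
  move=> u0 _ C mC; rewrite setTI; apply: sub_sigma_algebra.
  by exists u, C.
have mgX : measurable_fun [set: g_sigma_algebraType G]
    (fun w => g (X s w, X t w)).
  apply: (measurableT_comp mg).
  by apply: measurable_fun_pair; exact: mX.
by have := mgX measurableT _ mB; rewrite setTI.
Qed.

Context (X Y : R -> {RV P >-> R}) (k : R -> nat) (tau : nat -> R) (s t : R).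
Hypothesis XY : independent_processes X Y.
Hypothesis mk : forall n, measurable (k @^-1` [set n]).
Hypotheses (tau_ge0 : forall n, 0 <= tau n) (s_ge0 : 0 <= s) (t_ge0 : 0 <= t).

Let mK (ij : nat * nat) :
  measurable ((fun w => (k (Y s w), k (Y t w))) @^-1` [set ij]).
Proof.
have -> : (fun w => (k (Y s w), k (Y t w))) @^-1` [set ij] =
    (Y s @^-1` (k @^-1` [set ij.1])) `&` (Y t @^-1` (k @^-1` [set ij.2])).
  by case: ij => i j; apply/seteqP; split => w /= [-> ->].
by apply: measurableI; exact: measurable_funPTI.
Qed.

Let sK (ij : nat * nat) :
  sigma_process Y ((fun w => (k (Y s w), k (Y t w))) @^-1` [set ij]).
Proof.
(* [sigma_process_pair] concerns preimages under real-valued functions, so the event is written as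
   the level set at 1 of an indicator. *)
pose g (z : R * R) : R := \1_((k \o fst) @^-1` [set ij.1] `&`
                    (k \o snd) @^-1` [set ij.2]) z.
have -> : (fun w => (k (Y s w), k (Y t w))) @^-1` [set ij] =
   (fun w => g (Y s w, Y t w)) @^-1` [set 1%R].
  case: ij @g => i j g; rewrite /g; apply/seteqP; split => w /=.
    by move=> [<- <-]; rewrite indicE mem_set.
  rewrite indicE; case: (boolP (_ \in _)) => [/set_mem/= [-> ->]//|_].
  by move=> /eqP; rewrite eq_sym oner_eq0.
apply: sigma_process_pair => //.
apply: measurable_indic; apply: measurableI.
- have := @measurable_fst _ _ R R measurableT _ (mk ij.1).
  by rewrite setTI.
- have := @measurable_snd _ _ R R measurableT _ (mk ij.2).
  by rewrite setTI.
Qed.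

Lemma measurable_random_times (g : R * R -> R) :
  measurable_fun [set: R * R] g ->
  measurable_fun [set: T]
    (fun w => g (X (tau (k (Y s w))) w, X (tau (k (Y t w))) w)).
Proof.
move=> mg; apply: (measurable_random_index mK
  (X := fun ij w => g (X (tau ij.1) w, X (tau ij.2) w))) => ij.
by apply: (measurableT_comp mg); exact: measurable_fun_pair.
Qed.

Lemma measurable_fun_random_times (h : R -> R -> R) :
  measurable_fun [set: T] (fun w => h (tau (k (Y s w))) (tau (k (Y t w)))).
Proof.
exact: (measurable_random_index mK
  (X := fun ij _ => h (tau ij.1) (tau ij.2))).
Qed.

(** [k] encodes a random time by an index and [tau] decodes it. The same statement thus serves the
    natural values of the geometric process and both grids of the subordinator. *)
Lemma expectation_random_times (g : R * R -> R) (h : R -> R -> R) :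
  measurable_fun [set: R * R] g -> (forall z, 0 <= g z) ->
  (forall i j, ('E_P[fun w => g (X (tau i) w, X (tau j) w)] =
     (h (tau i) (tau j))%:E)%E) ->
  ('E_P[fun w => g (X (tau (k (Y s w))) w, X (tau (k (Y t w))) w)] =
   'E_P[fun w => h (tau (k (Y s w))) (tau (k (Y t w)))])%E.
Proof.
move=> mg g0 gh.
apply: (expectation_indep_random_index mK
  (X := fun ij w => g (X (tau ij.1) w, X (tau ij.2) w))
  (h := fun ij => h (tau ij.1) (tau ij.2))) => //.
- move=> ij; apply: (measurableT_comp mg); exact: measurable_fun_pair.
- move=> ij B mB.
  rewrite setIC muleC; apply: XY; last exact: sK.
  exact: sigma_process_pair.
Qed.

End independent_processes_theory.

(** * Mixed Poisson laws *)

Section poisson_moments.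
Context (R : realType).
Local Open Scope ereal_scope.

Lemma nneseries_poisson_pmf (r : R) : (0 < r)%R ->
  \sum_(k <oo) (poisson_pmf r k)%:E = 1.
Proof.
move=> r0; have := @probability_setT _ _ _ (@poisson_prob R r 0).
rewrite /= /poisson_prob r0 => <-.
by rewrite nneseries_esumT// => k; rewrite lee_fin poisson_pmf_ge0.
Qed.

(** The Stein-Chen identity, from [k * p_k = r * p_(k-1)] for the Poisson weights; the term [k = 0]
    vanishes. Taking [f] constant, then the identity, yields the first two moments. *)
Lemma nneseries_poisson_pmf_shift (r : R) (f : nat -> R) : (0 < r)%R ->
  (forall k, 0 <= f k)%R ->
  \sum_(k <oo) (k%:R * f k * poisson_pmf r k)%:E =
  r%:E * \sum_(k <oo) (f k.+1 * poisson_pmf r k)%:E.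
Proof.
move=> r0 f0; rewrite nneseries_recl//=; last first.
  by move=> k _; rewrite lee_fin !mulr_ge0// poisson_pmf_ge0.
rewrite !mul0r add0e -nneseriesZl; last first.
  by move=> k _; rewrite lee_fin mulr_ge0// poisson_pmf_ge0.
rewrite -(nneseries_addn 1); last first.
  by move=> k; rewrite lee_fin !mulr_ge0// poisson_pmf_ge0.
apply: eq_eseriesr => k _; rewrite addn1 -EFinM; congr EFin.
rewrite /poisson_pmf r0 factS natrM invfM exprS.
have k0 : (k.+1%:R != 0 :> R)%R by rewrite pnatr_eq0.
by field; rewrite nat1r k0 pnatr_eq0 -lt0n fact_gt0.
Qed.

Lemma nneseries_poisson_pmf1 (r : R) : (0 < r)%R ->
  \sum_(k <oo) (k%:R * poisson_pmf r k)%:E = r%:E.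
Proof.
move=> r0; under eq_eseriesr => k _ do rewrite -[X in (X * _)%:E](mulr1 k%:R).
rewrite (nneseries_poisson_pmf_shift (f := fun=> 1%R))//.
under eq_eseriesr => k _ do rewrite mul1r.
by rewrite nneseries_poisson_pmf// mule1.
Qed.

Lemma nneseries_poisson_pmf2 (r : R) : (0 < r)%R ->
  \sum_(k <oo) (k%:R ^+ 2 * poisson_pmf r k)%:E = (r ^+ 2 + r)%:E.
Proof.
move=> r0; under eq_eseriesr => k _ do rewrite expr2.
rewrite (nneseries_poisson_pmf_shift (f := fun k => k%:R))//.
under eq_eseriesr => k _ do rewrite -natr1 mulrDl mul1r EFinD.
rewrite nneseriesD; [|by move=> *; rewrite lee_fin ?mulr_ge0 ?poisson_pmf_ge0..].
rewrite nneseries_poisson_pmf1// nneseries_poisson_pmf//.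
by rewrite -EFinD -EFinM mulrDr mulr1 expr2.
Qed.

End poisson_moments.

Section mixed_poisson.
Context d (T : measurableType d) (R : realType) (P : probability T R).
Context (Z : {RV P >-> R}) (rho : T -> R).
Hypothesis mrho : measurable_fun [set: T] rho.
Hypothesis rho_gt0 : {ae P, forall w, 0 < rho w}.
Hypothesis Zrho : forall k,
  (P [set w | Z w = k%:R] = \int[P]_w (poisson_pmf (rho w) k)%:E)%E.
Local Open Scope ereal_scope.

Let mZ k : measurable [set w | Z w = k%:R].
Proof. exact: (measurable_funPTI Z (measurable_set1 (k%:R))). Qed.

Let trivIset_Z : trivIset [set: nat] (fun k => [set w | Z w = k%:R]).
Proof.
apply/trivIsetP => i j _ _ ij; rewrite -subset0 => w [/= -> /eqP].
by rewrite eqr_nat (negbTE ij).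
Qed.

(** The sum over [k] and the integral over the mixing rate are exchanged, all terms being
    nonnegative. The pointwise identity is asked at positive rates, which have full measure. *)
Let nneseries_mixed_poisson (phi : nat -> R) (f : T -> R) :
  (forall k, 0 <= phi k)%R -> (forall w, 0 <= f w)%R ->
  measurable_fun [set: T] f ->
  (forall w, (0 < rho w)%R ->
     \sum_(k <oo) (phi k * poisson_pmf (rho w) k)%:E = (f w)%:E) ->
  \sum_(k <oo) (phi k)%:E * P [set w | Z w = k%:R] = 'E_P[f].
Proof.
move=> phi0 f0 mf phif.
have mpmf k : measurable_fun [set: T] (fun w => poisson_pmf (rho w) k).
  exact: (measurableT_comp (measurable_poisson_pmf k measurableT) mrho).
have pmf0 k w : 0 <= (phi k * poisson_pmf (rho w) k)%:E.
  by rewrite lee_fin mulr_ge0// poisson_pmf_ge0.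
under eq_eseriesr => k _.
  rewrite Zrho -ge0_integralZl//; first last.
  - by rewrite lee_fin.
  - by move=> w _; rewrite lee_fin poisson_pmf_ge0.
  - exact/measurable_EFinP.
  under eq_integral do rewrite -EFinM.
  over.
have mphi k : measurable_fun [set: T]
    (fun w => (phi k * poisson_pmf (rho w) k)%:E).
  by apply/measurable_EFinP; exact: measurable_funM.
rewrite -integral_nneseries// expectationE; apply: ge0_ae_eq_integral => //.
- by apply: ge0_emeasurable_sum.
- exact/measurable_EFinP.
- by move=> w _; exact: nneseries_ge0.
- by move=> w _; rewrite lee_fin.
- by apply: filterS rho_gt0 => w /phif.
Qed.

(** The masses at the naturals sum to 1, by the case [phi = 1] of the series identity, which leaves
    mass 0 outside. *)
Lemma mixed_poisson_nat : {ae P, forall w, Z w \is a Num.nat}.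
Proof.
pose U := \bigcup_k [set w | Z w = k%:R].
have mU : measurable U by exact: bigcup_measurable.
exists (~` U); split.
- exact: measurableC.
- rewrite probability_setC// /U measure_bigcup//.
  have -> : \sum_(k <oo | k \in [set: nat]) P [set w | Z w = k%:R] =
      \sum_(k <oo) (1%R)%:E * P [set w | Z w = k%:R].
    under [RHS]eq_eseriesr do rewrite mul1e.
    by apply: eq_eseriesl => k; rewrite in_setT.
  rewrite (nneseries_mixed_poisson (f := fun=> 1%R))//.
    by rewrite expectation_cst subee.
  move=> w w0; under eq_eseriesr do rewrite mul1r.
  exact: nneseries_poisson_pmf.
- move=> w /=; apply: contra_not => -[k _ /= ->]; exact: Num.Theory.natr_nat.
Qed.

(** [Z] is almost surely natural, hence equal to its truncation; the latter is a countable random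
    index, so the expectation splits into the series already computed. *)
Let expectation_mixed_poisson (phi : R -> R) (f : T -> R) :
  (forall x, 0 <= phi x)%R -> (forall w, 0 <= f w)%R ->
  measurable_fun [set: R] phi -> measurable_fun [set: T] f ->
  (forall w, (0 < rho w)%R ->
     \sum_(k <oo) (phi k%:R * poisson_pmf (rho w) k)%:E = (f w)%:E) ->
  'E_P[fun w => phi (Z w)] = 'E_P[f].
Proof.
move=> phi0 f0 mphi mf phif.
rewrite -(nneseries_mixed_poisson (f := f) (phi := fun k => phi k%:R))//.
have mK k : measurable ((Num.truncn \o Z) @^-1` [set k]).
  by rewrite comp_preimage; exact: (measurable_funPTI Z (measurable_truncn k)).
have Znat := mixed_poisson_nat.
transitivity 'E_P[fun w => phi (Num.truncn (Z w))%:R].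
  apply: ae_eq_expectation.
  - exact: measurableT_comp.
  - exact: (measurable_random_index mK (X := fun k _ => phi k%:R)).
  - by apply: filterS Znat => w /truncnK ->.
rewrite (expectation_random_index P mK (X := fun k _ => phi k%:R))//.
apply: eq_eseriesr => k _; rewrite /pickle_inv/= eqxx/= integral_cst//; congr (_ * _).
apply: ae_eq_probability => //.
by apply: filterS Znat => w Zw; split => [/= <-|/= ->]; rewrite ?natrK ?truncnK.
Qed.

Lemma expectation_norm_mixed_poisson :
  'E_P[fun w => `|Z w|%R] = 'E_P[fun w => `|rho w|%R].
Proof.
apply: (expectation_mixed_poisson (phi := fun x => `|x|%R)) => //.
  exact: measurableT_comp.
move=> w w0; under eq_eseriesr do rewrite ger0_norm//.
by rewrite nneseries_poisson_pmf1// gtr0_norm.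
Qed.

Lemma expectation_sqr_mixed_poisson :
  'E_P[fun w => (Z w ^+ 2)%R] = 'E_P[fun w => (rho w ^+ 2 + `|rho w|)%R].
Proof.
apply: (expectation_mixed_poisson (phi := fun x => x ^+ 2)%R) => //.
- by move=> x; exact: sqr_ge0.
- by move=> w; rewrite addr_ge0// sqr_ge0.
- apply: measurable_funD; first exact: measurable_funX.
  exact: measurableT_comp.
- by move=> w w0; rewrite nneseries_poisson_pmf2// gtr0_norm.
Qed.

End mixed_poisson.

(** * Exponential law *)

Section exponential_integrals.
Context (R : realType).
Variable m : R.
Hypothesis m_gt0 : 0 < m.
Local Notation leb := (@lebesgue_measure R).

Let cvg_expR_div (c : R) : 0 < c -> expR (- (x / c)) @[x --> +oo] --> (0 : R).
Proof.
move=> c_gt0.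
apply: (@cvg_comp _ _ _ (fun x : R => x / c) (fun x => expR (- x)) _ (pinfty_nbhs R)).
  by apply: gt0_cvgMly; [rewrite invr_gt0|exact: cvg_id].
exact: cvgr_expR.
Qed.

Let cvg_sqrt : (Num.sqrt x : R) @[x --> +oo] --> +oo.
Proof.
apply/cvgryPge => A; near=> x.
rewrite (le_trans (ler_norm A))// -sqrtr_sqr. apply: ler_wsqrtr.
by near: x; apply: nbhs_pinfty_ge; exact: num_real.
Unshelve. all: end_near. Qed.

(** Half of the exponent absorbs the linear factor, since [1 + y <= 2 * expR (y / 2)] for
    [y >= 0]. *)
Let cvg_lin_expR : (1 + x / m) * expR (- (x / m)) @[x --> +oo] --> (0 : R).
Proof.
apply: (@squeeze_cvgr _ _ _ _ (fun=> 0) (fun x : R => 2 * expR (- (x / m / 2)))).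
- near=> x.
  have x0 : 0 <= x / m by rewrite divr_ge0// ltW.
  rewrite mulr_ge0 ?expR_ge0 ?addr_ge0//=.
  have -> : - (x / m) = - (x / m / 2) + - (x / m / 2) by lra.
  rewrite expRD mulrA ler_wpM2r ?expR_ge0//.
  rewrite expRN ler_pdivrMr ?expR_gt0//.
  have := expR_ge1Dx (x / m / 2); lra.
- exact: cvg_cst.
- rewrite -[X in _ --> X](mulr0 2); apply: cvgMl_tmp.
  under eq_fun do rewrite -mulrA -invfM.
  by apply: cvg_expR_div; rewrite mulr_gt0.
Unshelve. all: end_near. Qed.

Lemma integral_expR_itvcy (a : R) :
  (\int[leb]_(x in `[a, +oo[) (expR (- (x / m)))%:E = (m * expR (- (a / m)))%:E)%E.
Proof.
have c : continuous (fun x : R => expR (- (x / m))).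
  move=> x; apply: continuous_comp; last exact: continuous_expR.
  by apply: continuousN; apply: cvgMr_tmp; exact: cvg_id.
rewrite (@ge0_continuous_FTC2y _ _ (fun x => - m * expR (- (x / m))) a 0).
- by rewrite -EFinB sub0r mulNr opprK.
- by move=> x _; exact: expR_ge0.
- exact: continuous_subspaceT.
- by rewrite -[X in _ --> X](mulr0 (- m)); apply: cvgMl_tmp; exact: cvg_expR_div.
- by move=> x _; exact: ex_derive.
- by apply: cvg_at_right_filter; apply: cvgMl_tmp; exact: c.
- move=> x _; rewrite derive1E derive_val /=.
  rewrite scaler0 add0r /GRing.scale/= mulr1.
  by field; rewrite gt_eqF.
Qed.

(* The integrand is the tail of the square of an exponential variable. *)
Lemma integral_expR_sqrt_itv0y :
  (\int[leb]_(x in `[0%R, +oo[) (expR (- (Num.sqrt x / m)))%:E =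
   (2 * m ^+ 2)%:E)%E.
Proof.
have csm : continuous (fun x : R => Num.sqrt x / m).
  by move=> x; apply: cvgMr_tmp; exact: sqrt_continuous.
have ce : continuous (fun x : R => expR (- (Num.sqrt x / m))).
  move=> x; apply: continuous_comp; last exact: continuous_expR.
  by apply: continuousN; exact: csm.
(* The substitution [x = u ^ 2] turns the integrand into [2 * u * expR (- (u / m))], whose primitive
   by parts is [F]. At 0, where the square root is not differentiable, right continuity of [F]
   suffices. *)
pose F x : R := - (2 * m ^+ 2) *
  ((1 + Num.sqrt x / m) * expR (- (Num.sqrt x / m))).
have dF (x : R) : 0 < x -> is_derive x 1 F (expR (- (Num.sqrt x / m))).
  move=> x0; have ds := is_derive1_sqrt x0.
  rewrite /F; apply: is_derive_eq.
  have s0 : Num.sqrt x != 0 by rewrite gt_eqF// sqrtr_gt0.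
  rewrite !scaler0 /GRing.scale/=.
  by field; rewrite s0 gt_eqF.
rewrite (@ge0_continuous_FTC2y _ _ F 0 0).
- by rewrite /F sqrtr0 mul0r oppr0 addr0 expR0 !mulr1 -EFinB sub0r opprK.
- by move=> x _; exact: expR_ge0.
- exact: continuous_subspaceT.
- rewrite -[X in _ --> X](mulr0 (- (2 * m ^+ 2))); apply: cvgMl_tmp.
  exact: (@cvg_comp _ _ _ (@Num.sqrt R)
    (fun x => (1 + x / m) * expR (- (x / m))) _ (pinfty_nbhs R)).
- by move=> x /dF ?; exact: ex_derive.
- apply: cvg_at_right_filter; apply: cvgMl_tmp; apply: cvgM; last exact: ce.
  by apply: cvgD; [exact: cvg_cst|exact: csm].
- by move=> x; rewrite in_itv/= andbT => /dF ?; rewrite derive1E derive_val.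
Qed.

End exponential_integrals.

Section exponential_law.
Context d (T : measurableType d) (R : realType) (P : probability T R).
Variables (m : R) (L : {RV P >-> R}).
Hypothesis m_gt0 : 0 < m.
Hypothesis LE : forall B : set R, measurable B ->
  distribution P L B = exponential_prob m^-1 B.
Local Open Scope ereal_scope.

Let exponential_tail (r : R) : (0 <= r)%R ->
  P [set w | (r < L w)%R] = (expR (- (r / m)))%:E.
Proof.
move=> r0.
have -> : P [set w | (r < L w)%R] = distribution P L `]r, +oo[.
  rewrite /distribution/= /pushforward; congr (P _).
  by apply/seteqP; split => w /=; rewrite in_itv/= andbT.
rewrite LE// /exponential_prob integral_itv_obnd_cbnd; last first.
  by apply/measurable_EFinP/measurable_funTS; exact: measurable_exponential_pdf.
transitivity (\int[lebesgue_measure]_(x in `[r, +oo[)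
    ((m^-1)%:E * (expR (- (x / m)))%:E)).
  apply: eq_integral => x; rewrite inE/= in_itv/= andbT => rx.
  by rewrite exponential_pdfE ?(le_trans r0)// mulNr (mulrC _ x).
rewrite ge0_integralZl//; first last.
- by rewrite lee_fin invr_ge0 ltW.
- apply/measurable_EFinP/measurable_funTS; apply: measurableT_comp => //.
  by apply: measurableT_comp => //; exact: measurable_funM.
by rewrite integral_expR_itvcy// -EFinM mulrA mulVf ?mul1r// gt_eqF.
Qed.

Lemma exponential_gt0 : {ae P, forall w, (0 < L w)%R}.
Proof.
have mL : measurable [set w | (0 < L w)%R].
  have -> : [set w | (0 < L w)%R] = L @^-1` `]0%R, +oo[.
    by apply/seteqP; split => w /=; rewrite in_itv/= andbT.
  exact: measurable_funPTI.
exists (~` [set w | (0 < L w)%R]); split => //.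
  exact: measurableC.
by rewrite probability_setC// exponential_tail// mul0r oppr0 expR0 subee.
Qed.

(** Layer-cake formula. It asks for a variable that is nonnegative everywhere, whereas [L] is so
    only almost surely, hence the absolute value. *)
Lemma expectation_norm_exponential : 'E_P[fun w => `|L w|%R] = m%:E.
Proof.
have mN : measurable_fun [set: T] (fun w => `|L w|%R) by exact: measurableT_comp.
pose L' : {RV P >-> R} := mfun_Sub (mem_set mN).
rewrite [LHS](ge0_expectation_ccdf (X := L')); last by move=> w; exact: normr_ge0.
transitivity (\int[lebesgue_measure]_(r in `[0%R, +oo[) (expR (- (r / m)))%:E).
  apply: eq_integral => r; rewrite inE/= in_itv/= andbT => r0.
  rewrite -exponential_tail// /ccdf /distribution /pushforward/=.
  apply: ae_eq_probability.
- exact: (measurable_funPTI L').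
- have -> : [set w | (r < L w)%R] = L @^-1` `]r, +oo[.
    by apply/seteqP; split => w /=; rewrite in_itv/= andbT.
  exact: measurable_funPTI.
- apply: filterS exponential_gt0 => w Lw /=.
  by rewrite in_itv/= andbT gtr0_norm.
by rewrite integral_expR_itvcy// mul0r oppr0 expR0 mulr1.
Qed.

(** Layer-cake formula again: almost surely [L] is positive, so the square exceeds [r] exactly when
    [L] exceeds [Num.sqrt r]. *)
Lemma expectation_sqr_exponential :
  'E_P[fun w => (L w ^+ 2)%R] = (2 * m ^+ 2)%:E.
Proof.
have mX : measurable_fun [set: T] (fun w => (L w ^+ 2)%R) by exact: measurable_funX.
pose L' : {RV P >-> R} := mfun_Sub (mem_set mX).
rewrite [LHS](ge0_expectation_ccdf (X := L'))//; last first.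
  by move=> w; exact: sqr_ge0.
rewrite -integral_expR_sqrt_itv0y//.
apply: eq_integral => r; rewrite inE/= in_itv/= andbT => r0.
rewrite -exponential_tail ?sqrtr_ge0// /ccdf /distribution /pushforward/=.
apply: ae_eq_probability.
- exact: (measurable_funPTI L').
- have -> : [set w | (Num.sqrt r < L w)%R] = L @^-1` `]Num.sqrt r, +oo[.
    by apply/seteqP; split => w /=; rewrite in_itv/= andbT.
  exact: measurable_funPTI.
- apply: filterS exponential_gt0 => w Lw /=; rewrite in_itv/= andbT.
  rewrite -[X in (_ < X)%R <-> _]ger0_norm ?sqr_ge0// normrX.
  rewrite -ltr_sqrt ?exprn_gt0 ?normr_gt0 ?gt_eqF//.
  by rewrite sqrtr_sqr normr_id gtr0_norm.
Qed.

End exponential_law.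

(** * Second moments of mixed Poisson processes *)

Section second_moments.
Context d (T : measurableType d) (R : realType) (P : probability T R).
Local Open Scope ereal_scope.

Lemma ge0_expectationD (X Y : T -> R) :
  measurable_fun [set: T] X -> measurable_fun [set: T] Y ->
  (forall w, 0 <= X w)%R -> (forall w, 0 <= Y w)%R ->
  'E_P[fun w => (X w + Y w)%R] = 'E_P[X] + 'E_P[Y].
Proof.
move=> mX mY X0 Y0; rewrite !expectationE -ge0_integralD//.
- by move=> w _; rewrite lee_fin.
- exact/measurable_EFinP.
- by move=> w _; rewrite lee_fin.
- exact/measurable_EFinP.
Qed.

Lemma ge0_expectationZl (k : R) (X : T -> R) :
  measurable_fun [set: T] X -> (0 <= k)%R -> (forall w, 0 <= X w)%R ->
  'E_P[fun w => (k * X w)%R] = k%:E * 'E_P[X].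
Proof.
move=> mX k0 X0; rewrite !expectationE -ge0_integralZl_EFin//.
- by move=> w _; rewrite lee_fin.
- exact/measurable_EFinP.
Qed.

Lemma Lfun2_expectation_sqr (X : T -> R) : measurable_fun [set: T] X ->
  'E_P[fun w => (X w ^+ 2)%R] < +oo -> X \in Lfun P 2%:E.
Proof.
move=> mX X2; rewrite inE; apply/andP; split; rewrite inE//=.
rewrite /finite_norm unlock/= poweR_lty//.
rewrite expectationE in X2; apply: le_lt_trans X2.
rewrite le_eqVlt; apply/orP; left; apply/eqP; apply: eq_integral => w _ /=.
by rewrite powR_mulrn// real_normK// num_real.
Qed.

Lemma Lfun1_expectation_sqr (X : T -> R) : measurable_fun [set: T] X ->
  'E_P[fun w => (X w ^+ 2)%R] < +oo -> X \in Lfun P 1.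
Proof.
move=> mX X2; apply: Lfun_subset12; first exact: fin_num_measure.
exact: Lfun2_expectation_sqr.
Qed.

(** Expectation of [2 * X * Y = X ^ 2 + Y ^ 2 - (Y - X) ^ 2]. The finite second moments put every
    term in L1, so that subtraction is legitimate. *)
Lemma expectation_mul_polarization (X Y : T -> R) (a b c : R) :
  measurable_fun [set: T] X -> measurable_fun [set: T] Y ->
  'E_P[fun w => (X w ^+ 2)%R] = a%:E ->
  'E_P[fun w => (Y w ^+ 2)%R] = b%:E ->
  'E_P[fun w => ((Y w - X w) ^+ 2)%R] = c%:E ->
  'E_P[fun w => (X w * Y w)%R] = ((a + b - c) / 2)%:E.
Proof.
move=> mX mY Xa Yb XYc.
have X2 : X \in Lfun P 2%:E by rewrite Lfun2_expectation_sqr// Xa ltry.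
have Y2 : Y \in Lfun P 2%:E by rewrite Lfun2_expectation_sqr// Yb ltry.
have XY1 : (fun w => (X w * Y w)%R) \in Lfun P 1 by exact: Lfun2_mul_Lfun1.
have : 'E_P[fun w => ((Y w - X w) ^+ 2)%R] =
    'E_P[fun w => (Y w ^+ 2)%R] + 'E_P[fun w => (X w ^+ 2)%R] -
    2%:E * 'E_P[fun w => (X w * Y w)%R].
  have X1 : (fun w => (X w ^+ 2)%R) \in Lfun P 1 by exact: Lfun2_mul_Lfun1.
  have Y1 : (fun w => (Y w ^+ 2)%R) \in Lfun P 1 by exact: Lfun2_mul_Lfun1.
  rewrite -expectationD// -expectationZl// -expectationB//; first last.
  - exact: Lfun_scale.
  - exact: (@rpredD _ (Lfun P 1)).
  by congr expectation; apply/funext => w /=; ring.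
rewrite XYc Xa Yb -(fineK (expectation_fin_num XY1)) => -[->].
by congr EFin; field.
Qed.

End second_moments.

(* Both the Poisson process (constant [rho]) and the geometric counting
   process (exponential [rho]) are of this form. *)
Definition mixed_poisson_increments d (T : measurableType d) (R : realType)
    (P : probability T R) (rho : T -> R) (X : R -> {RV P >-> R}) : Prop :=
  {ae P, forall w, X 0 w = 0} /\
  forall (s t : R) (k : nat), 0 <= s -> s < t ->
    P [set w | X t w - X s w = k%:R] =
    (\int[P]_w (poisson_pmf (rho w * (t - s)) k)%:E)%E.

Section mixed_poisson_process.
Context d (T : measurableType d) (R : realType) (P : probability T R).
Context (rho : T -> R) (X : R -> {RV P >-> R}) (m1 m2 : R).
Hypothesis mrho : measurable_fun [set: T] rho.
Hypothesis rho_gt0 : {ae P, forall w, 0 < rho w}.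
Hypothesis Xrho : mixed_poisson_increments rho X.
Hypothesis rho_m1 : ('E_P[fun w => (`|rho w|)%R] = m1%:E)%E.
Hypothesis rho_m2 : ('E_P[fun w => (rho w ^+ 2)%R] = m2%:E)%E.

Let incr (s t : R) : {RV P >-> R} :=
  mfun_Sub (mem_set (measurable_funB (measurable_funPT (X t)) (measurable_funPT (X s)))).

Let mrhoh (h : R) : measurable_fun [set: T] (fun w => rho w * h).
Proof. exact: measurable_funM. Qed.

Let rhoh_gt0 (h : R) : 0 < h -> {ae P, forall w, 0 < rho w * h}.
Proof. by move=> h0; apply: filterS rho_gt0 => w r0; exact: mulr_gt0. Qed.

Lemma mixed_poisson_increment_nat (s t : R) : 0 <= s -> s <= t ->
  {ae P, forall w, X t w - X s w \is a Num.nat}.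
Proof.
move=> s0; rewrite le_eqVlt => /predU1P[->|st].
  by apply: nearW => w; rewrite subrr.
apply: (mixed_poisson_nat (Z := incr s t) (mrhoh (t - s))).
- by apply: rhoh_gt0; rewrite subr_gt0.
- by move=> k; apply: (Xrho.2 s t k).
Qed.

Lemma mixed_poisson_process_nat (t : R) : 0 <= t ->
  {ae P, forall w, X t w \is a Num.nat}.
Proof.
move=> t0.
apply: filterS2 Xrho.1 (mixed_poisson_increment_nat (lexx 0) t0) => w ->.
by rewrite subr0.
Qed.

Lemma expectation_norm_mixed_poisson_process (t : R) : 0 <= t ->
  ('E_P[fun w => (`|X t w|)%R] = (m1 * t)%:E)%E.
Proof.
(* Time 0 is apart: the increment law is given for [s < t], as [poisson_pmf] has the default value 1
   at rate 0. *)
rewrite le_eqVlt => /predU1P[<-|t0].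
  rewrite mulr0 -(expectation_cst P 0%R); apply: ae_eq_expectation => //.
    exact: measurableT_comp.
  by apply: filterS Xrho.1 => w ->; rewrite normr0.
transitivity ('E_P[fun w => (`|incr 0 t w|)%R])%E.
  apply: ae_eq_expectation; [exact: measurableT_comp..|].
  by apply: filterS Xrho.1 => w /= ->; rewrite subr0.
rewrite (expectation_norm_mixed_poisson (mrhoh (t - 0))).
- rewrite subr0 (_ : (fun w => _) = (fun w => t * `|rho w|)); last first.
    by apply/funext => w; rewrite normrM mulrC (gtr0_norm t0).
  rewrite ge0_expectationZl ?rho_m1 -?EFinM ?(mulrC t)// ?ltW//.
  exact: measurableT_comp.
- by apply: rhoh_gt0; rewrite subr0.
- by move=> k; exact: (Xrho.2 0 t k).
Qed.

Lemma expectation_sqr_mixed_poisson_increment (s t : R) : 0 <= s -> s <= t ->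
  ('E_P[fun w => ((X t w - X s w) ^+ 2)%R] =
   (m2 * (t - s) ^+ 2 + m1 * (t - s))%:E)%E.
Proof.
move=> s0; rewrite le_eqVlt => /predU1P[->|st].
  rewrite subrr expr0n/= !mulr0 addr0 -(expectation_cst P 0%R); congr expectation.
  by apply/funext => w/=; rewrite subrr expr0n.
have h0 : 0 < t - s by rewrite subr_gt0.
have mn : measurable_fun [set: T] (fun w => `|rho w|).
  exact: measurableT_comp.
have m2' : measurable_fun [set: T] (fun w => rho w ^+ 2).
  exact: measurable_funX.
rewrite (expectation_sqr_mixed_poisson (Z := incr s t) (mrhoh (t - s))).
- rewrite (_ : (fun w => _) =
      (fun w => (t - s) ^+ 2 * rho w ^+ 2 + (t - s) * `|rho w|)); last first.
    by apply/funext => w; rewrite normrM (gtr0_norm h0) exprMn; ring.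
  rewrite ge0_expectationD ?ge0_expectationZl//.
  + by rewrite rho_m1 rho_m2 -!EFinM -EFinD; congr EFin; ring.
  + exact: ltW.
  + exact: sqr_ge0.
  + by move=> w; exact: sqr_ge0.
  + exact: measurable_funM.
  + exact: measurable_funM.
  + by move=> w; rewrite mulr_ge0 ?sqr_ge0.
  + by move=> w; rewrite mulr_ge0// ltW.
- exact: rhoh_gt0.
- by move=> k; exact: (Xrho.2 s t k).
Qed.

(** Increments of a mixed process are dependent in general, since they share the rate. Polarization
    bypasses this: only laws of single increments enter. *)
Let expectation_norm_mul_mixed_poisson_le (s t : R) : 0 <= s -> s <= t ->
  ('E_P[fun w => (`|X s w * X t w|)%R] = (m2 * s * t + m1 * s)%:E)%E.
Proof.
move=> s0 st; have t0 := le_trans s0 st.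
transitivity ('E_P[fun w => (X s w * X t w)%R])%E.
  apply: ae_eq_expectation.
  - by apply: measurableT_comp => //; exact: measurable_funM.
  - exact: measurable_funM.
  - apply: filterS2 (mixed_poisson_process_nat s0) (mixed_poisson_process_nat t0).
    by move=> w Xs Xt; rewrite ger0_norm// mulr_ge0// natr_ge0.
have sqr u : 0 <= u -> ('E_P[fun w => (X u w ^+ 2)%R] = (m2 * u ^+ 2 + m1 * u)%:E)%E.
  move=> u0; rewrite -[in RHS](subr0 u) -expectation_sqr_mixed_poisson_increment//.
  apply: ae_eq_expectation.
  - exact: measurable_funX.
  - by apply: measurable_funX; exact: measurable_funB.
  - by apply: filterS Xrho.1 => w ->; rewrite subr0.
rewrite (expectation_mul_polarization _ _ (sqr _ s0) (sqr _ t0)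
  (expectation_sqr_mixed_poisson_increment s0 st))//.
by congr EFin; lra.
Qed.

Lemma expectation_norm_mul_mixed_poisson_process (s t : R) : 0 <= s -> 0 <= t ->
  ('E_P[fun w => (`|X s w * X t w|)%R] = (m2 * s * t + m1 * Num.min s t)%:E)%E.
Proof.
move=> s0 t0; have [st|/ltW ts] := leP s t.
  exact: expectation_norm_mul_mixed_poisson_le.
under [X in 'E_P[X]%E]funext do rewrite mulrC.
by rewrite expectation_norm_mul_mixed_poisson_le// mulrAC.
Qed.

End mixed_poisson_process.

(** * Mixed Poisson instances and almost sure monotonicity of paths *)

Section increments_instances.
Context d (T : measurableType d) (R : realType) (P : probability T R).

Lemma poisson_process_mixed (lambda : R) (N : R -> {RV P >-> R}) :
  poisson_process lambda N -> mixed_poisson_increments (cst lambda) N.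
Proof.
move=> [[N0 _ _ _] Npmf]; split => // s t k s0 st.
transitivity ('E_P[cst (poisson_pmf (lambda * (t - s)) k)])%E.
  by rewrite expectation_cst Npmf.
exact: expectationE.
Qed.

Lemma conditionally_poisson_mixed (L : {RV P >-> R}) (G : R -> {RV P >-> R}) :
  conditionally_poisson L G -> mixed_poisson_increments L G.
Proof.
move=> [G0 _ GL]; split => // s t k s0 st.
(* The disintegration takes an infinite strictly increasing sequence of times, so [s < t] is
   prolonged to an arithmetic progression, of which only the first increment is observed. *)
have := GL 1%N (fun i => s + i%:R * (t - s)) (fun=> k) setT.
rewrite mul0r addr0 preimage_setT setTI => /(_ s0) /=.
rewrite bigcap_mkord big_ord1 mul0r mul1r addr0 subrKC => -> //; last first.
  by move=> i; rewrite ltrD2l ltr_pM2r ?subr_gt0// ltr_nat.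
by apply: eq_integral => w _; rewrite big_ord1 mul0r mul1r addr0 subrKC.
Qed.

(** Right continuity transfers the order from rational times. If [x t < x s], rationals [p] in []s,
    t[] and [q > t] with values within half the gap of [x s] and [x t] satisfy [p <= q] and
    [x q < x p]. *)
Lemma cadlag_nondecreasing (x : R -> R) : cadlag x ->
  (forall p q : rat, 0 <= p -> p <= q -> x (ratr p) <= x (ratr q)) ->
  forall s t, 0 <= s -> s <= t -> x s <= x t.
Proof.
move=> xc xpq s t s0; rewrite le_eqVlt => /predU1P[->//|st].
have t0 : 0 <= t by rewrite ltW// (le_lt_trans s0).
rewrite leNgt; apply/negP => xts.
have e0 : 0 < (x s - x t) / 2 by rewrite divr_gt0// subr_gt0.
have [/cvgrPdist_lt/(_ _ e0) xs _] := xc s s0.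
have [/cvgrPdist_lt/(_ _ e0) xt _] := xc t t0.
have ratr_near (u v : R) : u < v ->
    (\forall z \near u^'+, `|x u - x z| < (x s - x t) / 2) ->
    exists q : rat, [/\ u < ratr q, ratr q < v & `|x u - x (ratr q)| < (x s - x t) / 2].
  move=> uv [e /= e_gt0 eu].
  have uve : u < Num.min v (u + e) by rewrite lt_min uv ltrDl.
  have [q] := rat_in_itvoo uve; rewrite in_itv/= => /andP[uq].
  rewrite lt_min => /andP[qv que].
  exists q; split => //; apply: eu => //=.
  by rewrite ltr_distlC ltrBlDr (lt_trans uq) ?ltrDl ?que.
have [p [sp pt xsp]] := ratr_near _ _ st xs.
have t1 : t < t + 1 by rewrite ltrDl.
have [q [tq _ xtq]] := ratr_near _ _ t1 xt.
have pq : p <= q by rewrite -(ler_rat R) ltW// (lt_trans pt).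
have p0 : 0 <= p by rewrite -(ler_rat R) rmorph0 (le_trans s0)// ltW.
have := xpq p q p0 pq.
move: xsp xtq; rewrite !ltr_distlC; lra.
Qed.

(** The null set for each pair of times must become a single null set for all pairs. Pairs of
    rationals are countable, and cadlag paths extend the order from them to real times. *)
Lemma ae_nondecreasing (X : R -> {RV P >-> R}) :
  {ae P, forall w, cadlag (X ^~ w)} ->
  (forall s t, 0 <= s -> s <= t -> {ae P, forall w, X s w <= X t w}) ->
  {ae P, forall w, forall s t, 0 <= s -> s <= t -> X s w <= X t w}.
Proof.
move=> Xc Xst.
have Xrat : {ae P, forall w, forall p q : rat, 0 <= p -> p <= q ->
    X (ratr p) w <= X (ratr q) w}.
  have : {ae P, forall w, forall n : nat, forall p q : rat,
      unpickle n = Some (p, q) -> 0 <= p -> p <= q ->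
      X (ratr p) w <= X (ratr q) w}.
    apply: ae_foralln => n.
    case E : (@unpickle (rat * rat)%type n) => [[p q]|]; last exact: nearW.
    have [/andP[p0 pq]|] := boolP ((0 <= p) && (p <= q)); last first.
      move=> /negP pq; apply: nearW => w p' q' [<- <-] p0 pq'.
      by exfalso; apply: pq; rewrite p0.
    have : {ae P, forall w, X (ratr p) w <= X (ratr q) w}.
      by apply: Xst; rewrite ?ler_rat// ler0q.
    by apply: filterS => w h p' q' [<- <-].
  by apply: filterS => w h p q; apply: (h (pickle (p, q))); rewrite pickleK.
by apply: filterS2 Xc Xrat => w; exact: cadlag_nondecreasing.
Qed.

End increments_instances.

(** * Independent change of time *)

Section time_change_expectation.
Context d (T : measurableType d) (R : realType) (P : probability T R).
Context (X Y : R -> {RV P >-> R}) (g : R * R -> R) (h : R -> R -> R) (s t : R).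
Hypothesis XY : independent_processes X Y.
Hypothesis X_nd : {ae P, forall w, forall u v, 0 <= u -> u <= v ->
  0 <= X u w <= X v w}.
Hypotheses (s_ge0 : 0 <= s) (t_ge0 : 0 <= t).
Hypothesis Ys_ge0 : {ae P, forall w, 0 <= Y s w}.
Hypothesis Yt_ge0 : {ae P, forall w, 0 <= Y t w}.
Hypothesis mg : measurable_fun [set: R * R] g.
Hypothesis g_ge0 : forall z, 0 <= g z.
Hypothesis g_nd : forall x y x' y', 0 <= x -> x <= x' -> 0 <= y -> y <= y' ->
  g (x, y) <= g (x', y').
Hypothesis gh : forall x y, 0 <= x -> 0 <= y ->
  ('E_P[fun w => g (X x w, X y w)] = (h x y)%:E)%E.

Context (Z : T -> R).
Hypothesis mZ : measurable_fun [set: T] Z.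
Hypothesis Z_ge0 : forall w, 0 <= Z w.
Hypothesis ZE : {ae P, forall w, Z w = g (X (Y s w) w, X (Y t w) w)}.

(** Both roundings share this index: for [c > 0] and [x >= 0] with index [n], the point [x] lies
    between [lower_grid c n] and [upper_grid c n]. *)
Definition grid_index (c x : R) : nat := Num.truncn (x / c).
Definition lower_grid (c : R) (n : nat) : R := c * n%:R.
Definition upper_grid (c : R) (n : nat) : R := c * n.+1%:R.

Lemma measurable_grid_index (c : R) (n : nat) :
  measurable (grid_index c @^-1` [set n]).
Proof.
have mdiv : measurable_fun [set: R] (fun x : R => x / c).
  exact: measurable_funM.
by rewrite -[_ @^-1` _]setTI; exact: (mdiv measurableT _ (measurable_truncn n)).
Qed.

Lemma lower_grid_le (c x : R) : 0 < c -> 0 <= x -> lower_grid c (grid_index c x) <= x.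
Proof.
move=> c0 x0; rewrite /lower_grid mulrC -ler_pdivlMr//.
by rewrite /grid_index truncn_le divr_ge0// ltW.
Qed.

Lemma upper_grid_ge (c x : R) : 0 < c -> x <= upper_grid c (grid_index c x).
Proof.
by move=> c0; rewrite /upper_grid mulrC -ler_pdivrMr//; exact/ltW/truncnS_gt.
Qed.

Let lo c x := lower_grid c (grid_index c x).
Let hi c x := upper_grid c (grid_index c x).

(** Kept apart, and ahead of the integrability hypotheses on [Y], because it is also the tool that
    bounds the second moment of the subordinator. *)
Lemma lower_grid_expectation (c : R) : 0 < c ->
  ('E_P[fun w => h (lo c (Y s w)) (lo c (Y t w))] <= 'E_P[Z])%E.
Proof.
move=> c0; have lo0 n : 0 <= lower_grid c n by rewrite mulr_ge0// ltW.
have mk := measurable_grid_index c.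
rewrite -(expectation_random_times XY mk lo0 s_ge0 t_ge0 mg g_ge0
  (fun i j => gh (lo0 i) (lo0 j))).
apply: expectation_le => //.
  exact: (measurable_random_times X Y _ s t mk mg).
apply: filterS2 (filterI Ys_ge0 Yt_ge0) (filterI X_nd ZE).
move=> w [Ys0 Yt0] [Xnd ->].
have Xs := Xnd _ _ (lo0 (grid_index c (Y s w))) (lower_grid_le c0 Ys0).
have Xt := Xnd _ _ (lo0 (grid_index c (Y t w))) (lower_grid_le c0 Yt0).
by move: Xs Xt => /andP[Xs0 Xs] /andP[Xt0 Xt]; exact: g_nd.
Qed.

Lemma upper_grid_expectation (c : R) : 0 < c ->
  ('E_P[Z] <= 'E_P[fun w => h (hi c (Y s w)) (hi c (Y t w))])%E.
Proof.
move=> c0; have hi0 n : 0 <= upper_grid c n by rewrite mulr_ge0// ltW.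
have mk := measurable_grid_index c.
rewrite -(expectation_random_times XY mk hi0 s_ge0 t_ge0 mg g_ge0
  (fun i j => gh (hi0 i) (hi0 j))).
apply: expectation_le => //.
  exact: (measurable_random_times X Y _ s t mk mg).
apply: filterS2 (filterI Ys_ge0 Yt_ge0) (filterI X_nd ZE).
move=> w [Ys0 Yt0] [Xnd ->].
have Xs := Xnd _ _ Ys0 (upper_grid_ge (Y s w) c0).
have Xt := Xnd _ _ Yt0 (upper_grid_ge (Y t w) c0).
by move: Xs Xt => /andP[Xs0 Xs] /andP[Xt0 Xt]; exact: g_nd.
Qed.

Hypothesis mh : measurable_fun [set: R * R] (fun z => h z.1 z.2).
Hypothesis h_nd : forall x y x' y', 0 <= x -> x <= x' -> 0 <= y -> y <= y' ->
  h x y <= h x' y'.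
Context (C : R).
Hypothesis h_shift : forall c x y, 0 < c -> c <= 1 -> 0 <= x -> 0 <= y ->
  h (x + c) (y + c) <= h x y + c * (C * (1 + x + y)).
Hypothesis C_ge0 : 0 <= C.
Hypothesis Ys_fin : ('E_P[fun w => `|Y s w|%R] < +oo)%E.
Hypothesis Yt_fin : ('E_P[fun w => `|Y t w|%R] < +oo)%E.

(* Rounding [Y] to a grid of mesh [c] makes the time discrete, at a cost that
   is linear in [c]; monotonicity of the paths of [X] gives both bounds. *)
Lemma expectation_time_change :
  ('E_P[Z] = 'E_P[fun w => `|h (Y s w) (Y t w)|%R])%E.
Proof.
have h0 x y : 0 <= x -> 0 <= y -> 0 <= h x y.
  by move=> x0 y0; rewrite -lee_fin -gh// expectation_ge0.
pose U w := `|h (Y s w) (Y t w)|.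
(* The error per unit of mesh allowed by [h_shift]; its finite mean makes the rounding error vanish
   with [c]. *)
pose V w := C * (1 + `|Y s w| + `|Y t w|).
have mU : measurable_fun [set: T] U.
  apply: measurableT_comp => //.
  exact: (measurableT_comp mh (measurable_fun_pair _ _)).
have V0 w : 0 <= V w by rewrite mulr_ge0// !addr_ge0.
have mV0 : measurable_fun [set: T] (fun w => 1 + `|Y s w| + `|Y t w|).
  by apply: measurable_funD; [apply: measurable_funD => //|]; exact: measurableT_comp.
have mV : measurable_fun [set: T] V by exact: measurable_funM.
have Vfin : ('E_P[V] < +oo)%E.
  rewrite ge0_expectationZl//.
  rewrite lte_mul_pinfty ?lee_fin// ge0_expectationD//.
  - rewrite lte_add_pinfty// ge0_expectationD//.
    + by rewrite lte_add_pinfty// (expectation_cst P 1) ltry.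
    + exact: measurableT_comp.
  - by apply: measurable_funD => //; exact: measurableT_comp.
  - exact: measurableT_comp.
have EV0 : (0 <= 'E_P[V])%E by exact: expectation_ge0.
have EVfin : 'E_P[V]%E \is a fin_num by rewrite ge0_fin_numE.
have mlh c (h' := fun x y : R => h (lower_grid c (grid_index c x)) (lower_grid c (grid_index c y))) :
    measurable_fun [set: T] (fun w => h' (Y s w) (Y t w)).
  exact: (measurable_fun_random_times Y (lower_grid c) s t (measurable_grid_index c) h).
have muh c (h' := fun x y : R => h (upper_grid c (grid_index c x)) (upper_grid c (grid_index c y))) :
    measurable_fun [set: T] (fun w => h' (Y s w) (Y t w)).
  exact: (measurable_fun_random_times Y (upper_grid c) s t (measurable_grid_index c) h).
have upper c : 0 < c -> c <= 1 -> ('E_P[Z] <= 'E_P[U] + c%:E * 'E_P[V])%E.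
  move=> c0 c1; apply: le_trans (upper_grid_expectation c0) _.
  have hi0 n : 0 <= upper_grid c n by rewrite mulr_ge0// ltW.
  rewrite -(ge0_expectationZl P mV (ltW c0) V0) -ge0_expectationD//; first last.
  - by move=> w; exact: mulr_ge0 (ltW c0) (V0 w).
  - by move=> w; exact: normr_ge0.
  - exact: measurable_funM.
  apply: expectation_le.
  - exact: muh.
  - by apply: measurable_funD => //; exact: measurable_funM.
  - by move=> w; apply: h0; exact: hi0.
  - by move=> w; exact: addr_ge0 (normr_ge0 _) (mulr_ge0 (ltW c0) (V0 w)).
  apply: filterS2 Ys_ge0 Yt_ge0 => w Ys0 Yt0.
  rewrite /U /V !ger0_norm ?h0//.
  apply: le_trans (h_shift c0 c1 Ys0 Yt0).
  have hic x : 0 <= x -> hi c x <= x + c.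
    move=> x0; rewrite /hi /upper_grid -natr1 mulrDr mulr1 lerD2r.
    exact: lower_grid_le.
  by apply: h_nd; rewrite ?hic//; exact: hi0.
have lower c : 0 < c -> c <= 1 -> ('E_P[U] <= 'E_P[Z] + c%:E * 'E_P[V])%E.
  move=> c0 c1.
  apply: le_trans (leeD (lower_grid_expectation c0) (lexx _)).
  have lo0 n : 0 <= lower_grid c n by rewrite mulr_ge0// ltW.
  rewrite -(ge0_expectationZl P mV (ltW c0) V0) -ge0_expectationD//; first last.
  - by move=> w; exact: mulr_ge0 (ltW c0) (V0 w).
  - by move=> w; apply: h0; exact: lo0.
  - exact: measurable_funM.
  - exact: mlh.
  apply: expectation_le => //.
  - by apply: measurable_funD; [exact: mlh|exact: measurable_funM].
  - by move=> w; exact: normr_ge0.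
  - by move=> w; exact: addr_ge0 (h0 _ _ (lo0 _) (lo0 _)) (mulr_ge0 (ltW c0) (V0 w)).
  apply: filterS2 Ys_ge0 Yt_ge0 => w Ys0 Yt0.
  rewrite /U /V !ger0_norm ?h0//.
  have loc x : x <= lo c x + c.
    by have := upper_grid_ge x c0; rewrite /upper_grid -natr1 mulrDr mulr1.
  apply: le_trans (h_nd Ys0 (loc _) Yt0 (loc _)) _.
  apply: le_trans (h_shift c0 c1 (lo0 _) (lo0 _)) _.
  rewrite lerD2l ler_pM2l// ler_wpM2l// !lerD//; exact: lower_grid_le.
have squeeze (a b : \bar R) :
    (forall c, 0 < c -> c <= 1 -> (a <= b + c%:E * 'E_P[V])%E) -> (a <= b)%E.
  move=> ab; apply/lee_addgt0Pr => e e0.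
  pose v := fine 'E_P[V]%E.
  have v0 : 0 <= v by exact: fine_ge0.
  (* The minimum enforces [c <= 1], as [h_shift] demands, and [v + 1] keeps the quotient meaningful
     when [v = 0]. *)
  have c0 : 0 < Num.min 1 (e / (v + 1)).
    by rewrite lt_min ltr01 divr_gt0// ltr_pwDr.
  apply: le_trans (ab _ c0 _) _; first by rewrite ge_min lexx.
  rewrite leeD2l// -(fineK EVfin) -EFinM lee_fin -/v.
  apply: (@le_trans _ _ (e / (v + 1) * v)).
    by rewrite ler_wpM2r// ge_min lexx orbT.
  rewrite mulrAC ler_pdivrMr ?ltr_pwDr// ler_wpM2l ?ltW// ltrDl//.
by apply/eqP; rewrite eq_le; apply/andP; split; apply: squeeze.
Qed.

End time_change_expectation.

(** * Second moments of Levy processes at integer times *)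

Section levy_second_moments.
Context d (T : measurableType d) (R : realType) (P : probability T R).
Local Open Scope ereal_scope.

Lemma eq_distribution_expectation (U V : {RV P >-> R}) (phi : R -> R) :
  (forall B, measurable B -> P (U @^-1` B) = P (V @^-1` B)) ->
  measurable_fun [set: R] phi -> (forall x, 0 <= phi x)%R ->
  'E_P[fun w => phi (U w)] = 'E_P[fun w => phi (V w)].
Proof.
move=> UV mphi phi0; rewrite !expectationE.
have mE : measurable_fun [set: R] (EFin \o phi) by exact/measurable_EFinP.
transitivity (\int[distribution P U]_x (phi x)%:E).
  by rewrite ge0_integral_distribution// => x; rewrite lee_fin.
transitivity (\int[distribution P V]_x (phi x)%:E); last first.
  by rewrite ge0_integral_distribution// => x; rewrite lee_fin.
by apply: eq_measure_integral => B mB _; exact: UV.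
Qed.

Context (X : R -> {RV P >-> R}) (m v : R).
Hypothesis X0 : {ae P, forall w, X 0%R w = 0%R}.
Hypothesis X_indep : independent_increments X.
Hypothesis X_stat : stationary_increments X.
Hypothesis X_nd : {ae P, forall w, forall s t, (0 <= s)%R -> (s <= t)%R ->
  (X s w <= X t w)%R}.
Hypothesis X_m : 'E_P[fun w => `|X 1%R w|%R] = m%:E.
Hypothesis X_v : 'E_P[fun w => (X 1%R w ^+ 2)%R] = v%:E.

Let incr (s t : R) : {RV P >-> R} :=
  mfun_Sub (mem_set (measurable_funB (measurable_funPT (X t)) (measurable_funPT (X s)))).

Lemma stationary_increment_expectation (s h : R) (phi : R -> R) :
  (0 <= s)%R -> (0 <= h)%R ->
  measurable_fun [set: R] phi -> (forall x, 0 <= phi x)%R ->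
  'E_P[fun w => phi (X (s + h)%R w - X s w)%R] = 'E_P[fun w => phi (X h w)].
Proof.
move=> s0 h0 mphi phi0.
transitivity 'E_P[fun w => phi (incr 0 h w)].
  apply: (eq_distribution_expectation (U := incr s (s + h))) => // B mB.
  exact: X_stat.
apply: ae_eq_expectation.
- exact: measurableT_comp.
- exact: measurableT_comp.
- by apply: filterS X0 => w /= ->; rewrite subr0.
Qed.

Let X_good (n : nat) : {ae P, forall w,
  [/\ X 0%R w = 0%R, (0 <= X n%:R w)%R & (X n%:R w <= X (n%:R + 1)%R w)%R]}.
Proof.
apply: filterS2 X0 X_nd => w w0 wnd; split => //.
- by rewrite -w0 wnd// ler0n.
- by rewrite wnd ?ler0n// lerDl.
Qed.

Let mnorm (U : {RV P >-> R}) : measurable_fun [set: T] (fun w => `|U w|%R).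
Proof. exact: measurableT_comp. Qed.

Let expectation_norm_incr (n : nat) :
  'E_P[fun w => `|incr n%:R (n%:R + 1) w|%R] = m%:E.
Proof.
rewrite -X_m.
exact: (stationary_increment_expectation (phi := fun x => `|x|%R)).
Qed.

(** On nondecreasing paths from 0 the absolute value is additive over increments, so stationarity
    gives the induction step. Integer times suffice, since the geometric clock takes natural
    values. *)
Lemma expectation_norm_levy (n : nat) :
  'E_P[fun w => `|X n%:R w|%R] = (n%:R * m)%:E.
Proof.
elim: n => [|n IHn].
  rewrite mul0r -(expectation_cst P 0%R); apply: ae_eq_expectation => //.
  by apply: filterS X0 => w /= ->; rewrite normr0.
transitivity 'E_P[fun w => (`|X n%:R w| + `|incr n%:R (n%:R + 1) w|)%R].
  apply: ae_eq_expectation => //; first by apply: measurable_funD.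
  apply: filterS (X_good n) => w [_ Xn0 Xn] /=; rewrite -natr1.
  by rewrite !ger0_norm ?subr_ge0// ?subrKC// (le_trans Xn0).
rewrite ge0_expectationD// IHn expectation_norm_incr.
by rewrite -EFinD -natr1 mulrDl mul1r.
Qed.

Let incr_indep (n : nat) (A B : set R) : measurable A -> measurable B ->
  P (incr 0 n%:R @^-1` A `&` incr n%:R (n%:R + 1) @^-1` B) =
  P (incr 0 n%:R @^-1` A) * P (incr n%:R (n%:R + 1) @^-1` B).
Proof.
move=> mA mB.
(* The times are 0, [n], [n + 1], then constant, which is admissible because
   [independent_increments] ranges over nondecreasing sequences. *)
pose t i : R := if i is j.+1 then (if j is 0 then n%:R else n%:R + 1)%R else 0%R.
have := @X_indep 2%N t (fun i => if i is 0 then A else B).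
rewrite bigcap_mkord !big_ord_recr !big_ord0/= setTI mul1e; apply => //.
- by move=> [|[|i]]; rewrite /t ?ler0n ?lerDl.
- by case.
Qed.

(** Squaring a sum of [n] independent unit increments gives [n] diagonal terms [v] and [n ^ 2 - n]
    cross terms [m ^ 2]. *)
Lemma expectation_sqr_levy (n : nat) :
  'E_P[fun w => (X n%:R w ^+ 2)%R] = (n%:R * v + (n%:R ^+ 2 - n%:R) * m ^+ 2)%:E.
Proof.
have msqr (U : {RV P >-> R}) : measurable_fun [set: T] (fun w => (U w ^+ 2)%R).
  exact: measurable_funX.
elim: n => [|n IHn].
  rewrite expr0n/= subrr !mul0r addr0 -(expectation_cst P 0%R).
  apply: ae_eq_expectation => //.
  by apply: filterS X0 => w /= ->; rewrite expr0n.
have mprod : measurable_fun [set: T]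
    (fun w => `|incr 0 n%:R w * incr n%:R (n%:R + 1) w|%R).
  by apply: measurableT_comp => //; exact: measurable_funM.
have Emul : 'E_P[fun w => `|incr 0 n%:R w * incr n%:R (n%:R + 1) w|%R] =
    (n%:R * m * m)%:E.
  rewrite expectation_norm_mul//; last exact: incr_indep.
  rewrite expectation_norm_incr EFinM; congr (_ * _).
  rewrite -expectation_norm_levy; apply: ae_eq_expectation => //.
  by apply: filterS X0 => w /= ->; rewrite subr0.
transitivity 'E_P[fun w => (X n%:R w ^+ 2 + (incr n%:R (n%:R + 1) w ^+ 2 +
    2 * `|incr 0 n%:R w * incr n%:R (n%:R + 1) w|))%R].
  apply: ae_eq_expectation => //.
    apply: measurable_funD => //; apply: measurable_funD => //.
    exact: measurable_funM.
  apply: filterS (X_good n) => w [w0 Xn0 Xn] /=; rewrite -natr1 w0 subr0.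
  by rewrite ger0_norm ?mulr_ge0 ?subr_ge0//; ring.
have sqrE (U : {RV P >-> R}) w : (0 <= U w ^+ 2)%R by exact: sqr_ge0.
rewrite ge0_expectationD//; first last.
- by move=> w; exact: addr_ge0 (sqr_ge0 _) (mulr_ge0 (ler0n _ 2) (normr_ge0 _)).
- apply: measurable_funD => //; exact: measurable_funM.
rewrite ge0_expectationD//; first last.
- exact: measurable_funM.
rewrite ge0_expectationZl// Emul IHn.
rewrite (stationary_increment_expectation (phi := fun x => x ^+ 2)%R)//; first last.
- by move=> x; exact: sqr_ge0.
rewrite X_v -EFinM -!EFinD; congr EFin; rewrite -natr1; ring.
Qed.

(** Polarization, with the second moment of the increment read at time [k - j] by stationarity. *)
Lemma expectation_norm_mul_levy (j k : nat) : (j <= k)%N ->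
  'E_P[fun w => `|X j%:R w * X k%:R w|%R] =
  (j%:R * v + (j%:R * k%:R - j%:R) * m ^+ 2)%:E.
Proof.
move=> jk.
transitivity 'E_P[fun w => (X j%:R w * X k%:R w)%R].
  apply: ae_eq_expectation.
  - by apply: measurableT_comp => //; exact: measurable_funM.
  - exact: measurable_funM.
  - apply: filterS2 (X_good j) (X_good k) => w [_ Xj _] [_ Xk _].
    by rewrite ger0_norm// mulr_ge0.
have incr_sqr : 'E_P[fun w => ((X k%:R w - X j%:R w) ^+ 2)%R] =
    'E_P[fun w => (X (k - j)%:R w ^+ 2)%R].
  rewrite -(stationary_increment_expectation (s := j%:R) (phi := fun x => x ^+ 2)%R)//.
  - by rewrite -natrD subnKC.
  - by move=> x; exact: sqr_ge0.
rewrite expectation_sqr_levy in incr_sqr.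
rewrite (expectation_mul_polarization _ _ (expectation_sqr_levy j)
  (expectation_sqr_levy k) incr_sqr)//.
by congr EFin; rewrite natrB//; field.
Qed.

End levy_second_moments.

(** * The geometric subordinated Poisson process *)

Section geometric_counting.
Context d (T : measurableType d) (R : realType) (P : probability T R).
Context (mu : R) (G : R -> {RV P >-> R}).
Hypothesis mu_gt0 : 0 < mu.
Hypothesis G_geometric : geometric_counting_process mu G.

Let geometricP : exists L : {RV P >-> R},
  [/\ {ae P, forall w, 0 < L w}, mixed_poisson_increments L G,
      ('E_P[fun w => `|L w|%R] = mu%:E)%E &
      ('E_P[fun w => (L w ^+ 2)%R] = (2 * mu ^+ 2)%:E)%E].
Proof.
have [L [LE GL]] := G_geometric; exists L; split.
- exact: exponential_gt0 LE.
- exact: conditionally_poisson_mixed.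
- exact: expectation_norm_exponential LE.
- exact: expectation_sqr_exponential LE.
Qed.

Lemma geometric_nat (t : R) : 0 <= t -> {ae P, forall w, G t w \is a Num.nat}.
Proof.
by have [L [L0 GL _ _]] := geometricP; apply: mixed_poisson_process_nat GL _ => //.
Qed.

Lemma geometric_le (s t : R) : 0 <= s -> s <= t -> {ae P, forall w, G s w <= G t w}.
Proof.
move=> s0 st; have [L [L0 GL _ _]] := geometricP.
have : {ae P, forall w, G t w - G s w \is a Num.nat}.
  by apply: mixed_poisson_increment_nat GL _ _ _ _ => //.
by apply: filterS => w /natr_ge0; rewrite subr_ge0.
Qed.

Lemma expectation_norm_geometric (t : R) : 0 <= t ->
  ('E_P[fun w => `|G t w|%R] = (mu * t)%:E)%E.
Proof.
have [L [L0 GL m1 m2]] := geometricP.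
exact: (expectation_norm_mixed_poisson_process _ L0 GL m1).
Qed.

Lemma expectation_norm_mul_geometric (s t : R) : 0 <= s -> s <= t ->
  ('E_P[fun w => `|G s w * G t w|%R] = (2 * mu ^+ 2 * s * t + mu * s)%:E)%E.
Proof.
move=> s0 st; have [L [L0 GL m1 m2]] := geometricP.
rewrite (expectation_norm_mul_mixed_poisson_process _ L0 GL m1 m2)//.
  by rewrite min_l.
exact: le_trans st.
Qed.

End geometric_counting.

(** * Moments of the subordinated Poisson process at integer times *)

Section subordinated_poisson.
Context d (T : measurableType d) (R : realType) (P : probability T R).
Context (f : R -> R) (lambda : R) (N D Nf : R -> {RV P >-> R}).
Hypothesis lambda_gt0 : 0 < lambda.
Hypothesis N_poisson : poisson_process lambda N.
Hypothesis D_subordinator : subordinator f D.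
Hypothesis ND : independent_processes N D.
Hypothesis NfE : time_change N D Nf.

(** [h1] and [h2] are the means of [g1] and [g2] along the Poisson process at fixed times. The first
    moment ignores its second time, so that one two-time statement covers both. *)
Let h1 (x y : R) : R := lambda * x.
Let h2 (x y : R) : R := lambda ^+ 2 * x * y + lambda * Num.min x y.
Let g1 (z : R * R) : R := `|z.1|.
Let g2 (z : R * R) : R := `|z.1 * z.2|.

Let D_levy : levy_process D. Proof. by case: D_subordinator. Qed.

Let D0 : {ae P, forall w, D 0 w = 0}. Proof. by case: D_levy. Qed.

Let D_nd : {ae P, forall w, forall s t, 0 <= s -> s <= t -> D s w <= D t w}.
Proof. by case: D_subordinator. Qed.

Let D_ge0 (t : R) : 0 <= t -> {ae P, forall w, 0 <= D t w}.
Proof.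
move=> t0; apply: filterS2 D0 D_nd => w D0w Dw.
by have := Dw _ _ (lexx 0) t0; rewrite D0w.
Qed.

Let N_mixed : mixed_poisson_increments (cst lambda) N.
Proof. exact: poisson_process_mixed. Qed.

Let lambda_ae : {ae P, forall w, 0 < (cst lambda : T -> R) w}.
Proof. exact: nearW. Qed.

Let lambda_m1 : ('E_P[fun w => `|(cst lambda : T -> R) w|%R] = lambda%:E)%E.
Proof.
exact: etrans (expectation_cst P _) (congr1 EFin (gtr0_norm lambda_gt0)).
Qed.

Let lambda_m2 : ('E_P[fun w => ((cst lambda : T -> R) w ^+ 2)%R] = (lambda ^+ 2)%:E)%E.
Proof. exact: (expectation_cst P (lambda ^+ 2)). Qed.

Let N_nd : {ae P, forall w, forall u v, 0 <= u -> u <= v ->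
  0 <= N u w <= N v w}.
Proof.
have [[N0 _ _ Nc] _] := N_poisson.
have Nst s t : 0 <= s -> s <= t -> {ae P, forall w, N s w <= N t w}.
  move=> s0 st.
  have : {ae P, forall w, N t w - N s w \is a Num.nat}.
    by apply: mixed_poisson_increment_nat N_mixed _ _ _ _ => //.
  by apply: filterS => w /natr_ge0; rewrite subr_ge0.
apply: filterS2 N0 (ae_nondecreasing Nc Nst) => w N0 Nw u v u0 uv.
by rewrite Nw// andbT -N0 Nw.
Qed.

Lemma subordinated_poisson_ge0 (t : R) : 0 <= t -> {ae P, forall w, 0 <= Nf t w}.
Proof.
move=> t0; have Nft := NfE t0.
apply: filterS3 N_nd (D_ge0 t0) Nft => w Nw Dt ->.
by have /andP[] := Nw _ _ Dt (lexx _).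
Qed.

Let mg1 : measurable_fun [set: R * R] g1.
Proof. exact: measurableT_comp. Qed.

Let mg2 : measurable_fun [set: R * R] g2.
Proof. by apply: measurableT_comp => //; exact: measurable_funM. Qed.

Let g1_nd (x y x' y' : R) : 0 <= x -> x <= x' -> 0 <= y -> y <= y' ->
  g1 (x, y) <= g1 (x', y').
Proof. by move=> x0 xx' _ _; rewrite /g1/= !ger0_norm// (le_trans x0). Qed.

Let g2_nd (x y x' y' : R) : 0 <= x -> x <= x' -> 0 <= y -> y <= y' ->
  g2 (x, y) <= g2 (x', y').
Proof.
move=> x0 xx' y0 yy'; rewrite /g2/= !normrM ler_pM// !ger0_norm//.
  exact: le_trans xx'.
exact: le_trans yy'.
Qed.

Let g1h1 (x y : R) : 0 <= x -> 0 <= y ->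
  ('E_P[fun w => g1 (N x w, N y w)] = (h1 x y)%:E)%E.
Proof.
move=> x0 _.
exact: (expectation_norm_mixed_poisson_process _ lambda_ae N_mixed lambda_m1).
Qed.

Let g2h2 (x y : R) : 0 <= x -> 0 <= y ->
  ('E_P[fun w => g2 (N x w, N y w)] = (h2 x y)%:E)%E.
Proof.
exact: (expectation_norm_mul_mixed_poisson_process _ lambda_ae N_mixed
  lambda_m1 lambda_m2).
Qed.

Let mh1 : measurable_fun [set: R * R] (fun z => h1 z.1 z.2).
Proof. exact: measurable_funM. Qed.

Let mh2 : measurable_fun [set: R * R] (fun z => h2 z.1 z.2).
Proof.
apply: measurable_funD.
  by apply: measurable_funM => //; exact: measurable_funM.
by apply: measurable_funM => //; exact: measurable_minr.
Qed.

Let h1_nd (x y x' y' : R) : 0 <= x -> x <= x' -> 0 <= y -> y <= y' ->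
  h1 x y <= h1 x' y'.
Proof. by move=> _ xx' _ _; rewrite /h1 ler_pM2l. Qed.

Let h2_nd (x y x' y' : R) : 0 <= x -> x <= x' -> 0 <= y -> y <= y' ->
  h2 x y <= h2 x' y'.
Proof.
move=> x0 xx' y0 yy'; rewrite /h2 -!(mulrA (lambda ^+ 2)).
apply: lerD; first by apply: (ler_wpM2l (sqr_ge0 _)); exact: ler_pM.
by rewrite ler_pM2l// le_min !ge_min xx' yy' orbT.
Qed.

(** Shifting both times by [c] raises [h2] by [c * (lambda ^ 2 * (x + y + c) + lambda)], which is at
    most [c * C * (1 + x + y)] once [c <= 1]. The increase of [h1] is only [c * lambda]. *)
Let C : R := lambda ^+ 2 + lambda.

Let h1_shift (c x y : R) : 0 < c -> c <= 1 -> 0 <= x -> 0 <= y ->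
  h1 (x + c) (y + c) <= h1 x y + c * (C * (1 + x + y)).
Proof.
move=> c0 c1 x0 y0; rewrite /h1 /C -subr_ge0.
have -> : lambda * x + c * ((lambda ^+ 2 + lambda) * (1 + x + y)) -
    lambda * (x + c) =
    c * (lambda ^+ 2 * (1 + x + y) + lambda * (x + y)) by ring.
by rewrite mulr_ge0 ?addr_ge0 ?mulr_ge0 ?addr_ge0 ?sqr_ge0 ?(ltW c0) ?(ltW lambda_gt0).
Qed.

Let h2_shift (c x y : R) : 0 < c -> c <= 1 -> 0 <= x -> 0 <= y ->
  h2 (x + c) (y + c) <= h2 x y + c * (C * (1 + x + y)).
Proof.
move=> c0 c1 x0 y0; rewrite /h2 /C -addr_minl -subr_ge0.
set z := Num.min x y.
have -> : lambda ^+ 2 * x * y + lambda * z +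
    c * ((lambda ^+ 2 + lambda) * (1 + x + y)) -
    (lambda ^+ 2 * (x + c) * (y + c) + lambda * (z + c)) =
    c * (lambda ^+ 2 * (1 - c) + lambda * (x + y)) by ring.
have c1' : 0 <= 1 - c by rewrite subr_ge0.
exact: mulr_ge0 (ltW c0) (addr_ge0 (mulr_ge0 (sqr_ge0 _) c1')
  (mulr_ge0 (ltW lambda_gt0) (addr_ge0 x0 y0))).
Qed.

Let C_ge0 : 0 <= C. Proof. by rewrite addr_ge0 ?ltW// exprn_gt0. Qed.

Lemma subordinator_sqr_fin : ('E_P[fun w => (Nf 1 w ^+ 2)%R] < +oo)%E ->
  ('E_P[fun w => (D 1 w ^+ 2)%R] < +oo)%E.
Proof.
move=> Nf_fin.
pose lo w := lower_grid 1 (grid_index 1 (D 1 w)) : R.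
have le_h2 : ('E_P[fun w => h2 (lo w) (lo w)] <= 'E_P[fun w => (Nf 1 w ^+ 2)%R])%E.
  apply: (lower_grid_expectation (X := N) (Y := D) (g := g2) (s := 1) (t := 1)) => //.
  - exact: D_ge0.
  - exact: D_ge0.
  - by move=> z; exact: normr_ge0.
  - exact: measurable_funX.
  - by move=> w; exact: sqr_ge0.
  - have := NfE ler01; apply: filterS => w ->.
    by rewrite /g2/= -expr2 ger0_norm// sqr_ge0.
have mlo : measurable_fun [set: T] (fun w => h2 (lo w) (lo w)).
  exact: (measurable_fun_random_times D (lower_grid 1) 1 1 (measurable_grid_index 1)).
have h20 w : 0 <= h2 (lo w) (lo w).
  have lo0 : 0 <= lo w by rewrite /lo /lower_grid mul1r.
  rewrite /h2 minxx; exact: addr_ge0 (mulr_ge0 (mulr_ge0 (sqr_ge0 _) lo0) lo0)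
    (mulr_ge0 (ltW lambda_gt0) lo0).
(* With [D 1 <= lo + 1] and [(lo + 1) ^ 2 <= 2 * lo ^ 2 + 2], the factor [2 / lambda ^ 2] rescales
   the quadratic term of [h2] to [2 * lo ^ 2]. *)
apply: (@le_lt_trans _ _
  'E_P[fun w => (2 / lambda ^+ 2 * h2 (lo w) (lo w) + 2)%R]%E).
  apply: expectation_le.
  - exact: measurable_funX.
  - by apply: measurable_funD => //; exact: measurable_funM.
  - by move=> w; exact: sqr_ge0.
  - by move=> w; rewrite addr_ge0// mulr_ge0// divr_ge0// sqr_ge0.
  - apply: filterS (D_ge0 ler01) => w Dw.
    have Dlo : D 1 w <= lo w + 1.
      have := upper_grid_ge (D 1 w) (@ltr01 R).
      by rewrite /upper_grid -natr1 mulrDr mulr1.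
    have lo0 : 0 <= lo w by rewrite /lo /lower_grid mul1r.
    have -> : 2 / lambda ^+ 2 * h2 (lo w) (lo w) = 2 * lo w ^+ 2 + 2 / lambda * lo w.
      by rewrite /h2 minxx; field; rewrite gt_eqF.
    apply: (@le_trans _ _ ((lo w + 1) ^+ 2)).
      by rewrite ler_sqr ?nnegrE ?addr_ge0.
    have lo1 : 0 <= (lo w - 1) ^+ 2 by exact: sqr_ge0.
    have lo2 : 0 <= 2 / lambda * lo w by rewrite mulr_ge0 ?divr_ge0// ltW.
    by move: lo1 lo2; rewrite !expr2; lra.
rewrite ge0_expectationD//; first last.
- by move=> w; rewrite mulr_ge0// divr_ge0// sqr_ge0.
- exact: measurable_funM.
rewrite ge0_expectationZl//; last by rewrite divr_ge0// sqr_ge0.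
rewrite (expectation_cst P 2) lte_add_pinfty ?ltry// lte_mul_pinfty//.
  by rewrite lee_fin divr_ge0// sqr_ge0.
exact: le_lt_trans Nf_fin.
Qed.

Context (m v : R).
Hypothesis D_m : ('E_P[fun w => `|D 1 w|%R] = m%:E)%E.
Hypothesis D_v : ('E_P[fun w => (D 1 w ^+ 2)%R] = v%:E)%E.

Let D_norm (n : nat) : ('E_P[fun w => `|D n%:R w|%R] = (n%:R * m)%:E)%E.
Proof. by have [_ Di Ds _] := D_levy; exact: expectation_norm_levy. Qed.

Let D_mul (j k : nat) : (j <= k)%N ->
  ('E_P[fun w => `|D j%:R w * D k%:R w|%R] =
  (j%:R * v + (j%:R * k%:R - j%:R) * m ^+ 2)%:E)%E.
Proof. by have [_ Di Ds _] := D_levy; exact: expectation_norm_mul_levy. Qed.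

Lemma expectation_norm_subordinated_poisson (n : nat) :
  ('E_P[fun w => `|Nf n%:R w|%R] = (lambda * m * n%:R)%:E)%E.
Proof.
have mD : measurable_fun [set: T] (fun w => `|D n%:R w|) by exact: measurableT_comp.
have D_fin : ('E_P[fun w => `|D n%:R w|%R] < +oo)%E by rewrite D_norm ltry.
rewrite (expectation_time_change ND N_nd (ler0n R n) (ler0n R n)
  (D_ge0 (ler0n R n)) (D_ge0 (ler0n R n)) mg1 _ g1_nd g1h1 _ _ _ mh1 h1_nd
  h1_shift C_ge0 D_fin D_fin)//.
- rewrite (_ : (fun w => _) = (fun w => lambda * `|D n%:R w|)); last first.
    by apply/funext => w; rewrite /h1 normrM gtr0_norm.
  rewrite ge0_expectationZl// ?ltW// D_norm -EFinM.
  by congr EFin; ring.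
- by move=> z; exact: normr_ge0.
- exact: measurableT_comp.
- by have := NfE (ler0n R n); apply: filterS => w ->.
Qed.

(** Monotone paths turn the minimum in [h2] into [D] at time [j]. The coefficient
    [lambda ^ 2 * (v - m ^ 2) + lambda * m] is the variance of [Nf 1], as the law of total variance
    predicts. *)
Let expectation_norm_mul_subordinated_poisson_le (j k : nat) : (j <= k)%N ->
  ('E_P[fun w => `|Nf j%:R w * Nf k%:R w|%R] =
   ((lambda ^+ 2 * (v - m ^+ 2) + lambda * m) * j%:R +
    lambda ^+ 2 * m ^+ 2 * j%:R * k%:R)%:E)%E.
Proof.
move=> jk.
have mD (n : nat) : measurable_fun [set: T] (fun w => `|D n%:R w|).
  exact: measurableT_comp.
have mDD : measurable_fun [set: T] (fun w => `|D j%:R w * D k%:R w|).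
  by apply: measurableT_comp => //; exact: measurable_funM.
have D_fin n : ('E_P[fun w => `|D n%:R w|%R] < +oo)%E by rewrite D_norm ltry.
rewrite (expectation_time_change ND N_nd (ler0n R j) (ler0n R k)
  (D_ge0 (ler0n R j)) (D_ge0 (ler0n R k)) mg2 _ g2_nd g2h2 _ _ _ mh2 h2_nd
  h2_shift C_ge0 (D_fin j) (D_fin k))//.
- transitivity ('E_P[fun w => (lambda ^+ 2 * `|D j%:R w * D k%:R w| +
      lambda * `|D j%:R w|)%R])%E.
    apply: ae_eq_expectation.
    + apply: measurableT_comp => //.
      exact: (measurableT_comp mh2 (measurable_fun_pair _ _)).
    + by apply: measurable_funD; exact: measurable_funM.
    + apply: filterS2 D_nd (D_ge0 (ler0n R j)) => w Dw Dj.
      have Djk : D j%:R w <= D k%:R w by rewrite Dw ?ler0n ?ler_nat.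
      have Dk := le_trans Dj Djk.
      rewrite /h2 min_l// !ger0_norm ?mulr_ge0//; first by ring.
      exact: addr_ge0 (mulr_ge0 (mulr_ge0 (sqr_ge0 _) Dj) Dk)
        (mulr_ge0 (ltW lambda_gt0) Dj).
  rewrite ge0_expectationD; [|exact: measurable_funM|exact: measurable_funM| |].
  + rewrite !ge0_expectationZl// ?ltW ?exprn_gt0//.
    rewrite D_mul// D_norm -!EFinM -EFinD; congr EFin; ring.
  + by move=> w; rewrite mulr_ge0// sqr_ge0.
  + by move=> w; rewrite mulr_ge0// ltW.
- by move=> z; exact: normr_ge0.
- by apply: measurableT_comp => //; exact: measurable_funM.
- have Nfj := NfE (ler0n R j); have Nfk := NfE (ler0n R k).
  by apply: filterS2 Nfj Nfk => w -> ->.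
Qed.

Lemma expectation_norm_mul_subordinated_poisson (j k : nat) :
  ('E_P[fun w => `|Nf j%:R w * Nf k%:R w|%R] =
   ((lambda ^+ 2 * (v - m ^+ 2) + lambda * m) * Num.min j%:R k%:R +
    lambda ^+ 2 * m ^+ 2 * j%:R * k%:R)%:E)%E.
Proof.
have [jk|/ltnW kj] := leqP j k.
  by rewrite min_l ?ler_nat// expectation_norm_mul_subordinated_poisson_le.
rewrite (_ : (fun w => _) = (fun w => `|Nf k%:R w * Nf j%:R w|)); last first.
  by apply/funext => w; rewrite mulrC.
rewrite expectation_norm_mul_subordinated_poisson_le// min_r ?ler_nat//.
by congr EFin; ring.
Qed.

End subordinated_poisson.

(** * Evaluation at an independent geometric clock *)

Section geometric_time.
Context d (T : measurableType d) (R : realType) (P : probability T R).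
Context (mu a c : R) (G X Z : R -> {RV P >-> R}).
Hypothesis mu_gt0 : 0 < mu.
Hypothesis G_geometric : geometric_counting_process mu G.
Hypothesis GX : independent_processes G X.
Hypothesis ZX : forall t, 0 <= t ->
  {ae P, forall w, forall n : nat, G t w = n%:R -> Z t w = X n%:R w}.
Hypothesis X_ge0 : forall n : nat, {ae P, forall w, 0 <= X n%:R w}.
Hypothesis X_mean : forall n : nat,
  ('E_P[fun w => `|X n%:R w|%R] = (c * n%:R)%:E)%E.
Hypothesis X_prod : forall j k : nat,
  ('E_P[fun w => `|X j%:R w * X k%:R w|%R] =
   (a * Num.min j%:R k%:R + c ^+ 2 * j%:R * k%:R)%:E)%E.
Hypotheses (a_ge0 : 0 <= a) (c_ge0 : 0 <= c).

Let nat0 (n : nat) : 0 <= n%:R :> R. Proof. exact: ler0n. Qed.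

Let ZE (t : R) : 0 <= t ->
  {ae P, forall w, Z t w = X (Num.truncn (G t w))%:R w}.
Proof.
move=> t0; have ZXt := ZX t0.
apply: filterS2 ZXt (geometric_nat mu_gt0 G_geometric t0) => w Zt Gt.
by apply: Zt; rewrite truncnK.
Qed.

Let Z_ge0 (t : R) : 0 <= t -> {ae P, forall w, 0 <= Z t w}.
Proof.
move=> t0; have Xn : {ae P, forall w, forall n : nat, 0 <= X n%:R w}.
  exact: ae_foralln.
by have Zt := ZE t0; apply: filterS2 Zt Xn => w ->.
Qed.

Lemma expectation_geometric_time (t : R) : 0 <= t ->
  ('E_P[Z t] = (c * mu * t)%:E)%E.
Proof.
move=> t0.
have mg : measurable_fun [set: R * R] (fun z => `|z.1|).
  exact: measurableT_comp.
transitivity ('E_P[fun w => `|X (Num.truncn (G t w))%:R w|%R])%E.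
  apply: ae_eq_expectation => //.
    exact: (measurable_random_times X G _ t t (@measurable_truncn R) mg).
  have Zt := ZE t0; have Z0 := Z_ge0 t0.
  by apply: filterS2 Zt Z0 => w Zw; rewrite -Zw => Z0w; rewrite ger0_norm.
rewrite (expectation_random_times (h := fun x _ => c * x)
  (independent_processesC GX) (@measurable_truncn R) nat0 t0 t0 mg (fun=> normr_ge0 _)
  (fun i _ => X_mean i)).
transitivity ('E_P[fun w => (c * `|G t w|)%R])%E.
  apply: ae_eq_expectation.
  - exact: (measurable_fun_random_times G _ t t (@measurable_truncn R) (fun x _ => c * x)).
  - by apply: measurable_funM => //; exact: measurableT_comp.
  - apply: filterS (geometric_nat mu_gt0 G_geometric t0) => w Gw.
    by rewrite truncnK// ger0_norm// natr_ge0.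
rewrite ge0_expectationZl//; last exact: measurableT_comp.
by rewrite (expectation_norm_geometric mu_gt0 G_geometric t0) -EFinM mulrA.
Qed.

(** Averaging [X_prod] over the clock: the minimum becomes [G s], with mean [mu * s], and the
    product term brings in the mean of [G s * G t], namely [2 * mu ^ 2 * s * t + mu * s]. *)
Lemma expectation_mul_geometric_time (s t : R) : 0 <= s -> s <= t ->
  ('E_P[fun w => (Z s w * Z t w)%R] =
   ((a + c ^+ 2) * mu * s + 2 * c ^+ 2 * mu ^+ 2 * s * t)%:E)%E.
Proof.
move=> s0 st; have t0 := le_trans s0 st.
have mg : measurable_fun [set: R * R] (fun z => `|z.1 * z.2|).
  by apply: measurableT_comp => //; exact: measurable_funM.
transitivity ('E_P[fun w => `|X (Num.truncn (G s w))%:R w *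
    X (Num.truncn (G t w))%:R w|%R])%E.
  apply: ae_eq_expectation; first exact: measurable_funM.
    exact: (measurable_random_times X G _ s t (@measurable_truncn R) mg).
  have Zs := ZE s0; have Zt := ZE t0.
  apply: filterS2 (filterI Zs Zt) (filterI (Z_ge0 s0) (Z_ge0 t0)).
  by move=> w [Zsw Ztw] [Zs0 Zt0]; rewrite -Zsw -Ztw ger0_norm// mulr_ge0.
rewrite (expectation_random_times
  (h := fun x y => a * Num.min x y + c ^+ 2 * x * y)
  (independent_processesC GX) (@measurable_truncn R) nat0 s0 t0 mg (fun=> normr_ge0 _)
  X_prod).
have mGG : measurable_fun [set: T] (fun w => `|G s w * G t w|).
  by apply: measurableT_comp => //; exact: measurable_funM.
have mG : measurable_fun [set: T] (fun w => `|G s w|) by exact: measurableT_comp.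
transitivity ('E_P[fun w => (a * `|G s w| + c ^+ 2 * `|G s w * G t w|)%R])%E.
  apply: ae_eq_expectation.
  - exact: (measurable_fun_random_times G _ s t (@measurable_truncn R)
      (fun x y => a * Num.min x y + c ^+ 2 * x * y)).
  - by apply: measurable_funD; exact: measurable_funM.
  - apply: filterS3 (geometric_nat mu_gt0 G_geometric s0)
      (geometric_nat mu_gt0 G_geometric t0)
      (geometric_le mu_gt0 G_geometric s0 st) => w Gs Gt Gst.
    rewrite !truncnK// min_l// !ger0_norm ?mulr_ge0 ?natr_ge0//.
    by rewrite mulrA.
rewrite ge0_expectationD; [|exact: measurable_funM|exact: measurable_funM| |].
- rewrite !ge0_expectationZl ?sqr_ge0//.
  rewrite (expectation_norm_geometric mu_gt0 G_geometric s0).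
  rewrite (expectation_norm_mul_geometric mu_gt0 G_geometric s0 st).
  by rewrite -!EFinM -EFinD; congr EFin; ring.
- by move=> w; rewrite mulr_ge0.
- by move=> w; rewrite mulr_ge0// sqr_ge0.
Qed.

(** The product of the means removes one of the two copies of [c ^ 2 * mu ^ 2 * s * t]; the other
    reflects the variance of the exponential rate. Equal times are allowed, so the variance is the
    diagonal case. *)
Lemma covariance_geometric_time (s t : R) : 0 <= s -> s <= t ->
  (covariance P (Z t) (Z s) =
   ((a + c ^+ 2) * mu * s + c ^+ 2 * mu ^+ 2 * s * t)%:E)%E.
Proof.
move=> s0 st; have t0 := le_trans s0 st.
have Z2 u : 0 <= u -> (Z u : T -> R) \in Lfun P 2%:E.
  move=> u0; apply: Lfun2_expectation_sqr => //.
  by rewrite (expectation_mul_geometric_time u0 (lexx u)) ltry.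
have Z1 u : 0 <= u -> (Z u : T -> R) \in Lfun P 1.
  by move=> u0; apply: Lfun_subset12; [exact: fin_num_measure|exact: Z2].
rewrite covarianceC covarianceE ?Z1//; last exact: Lfun2_mul_Lfun1 (Z2 _ s0) (Z2 _ t0).
rewrite (expectation_mul_geometric_time s0 st) !expectation_geometric_time//.
by rewrite -EFinM -EFinB; congr EFin; ring.
Qed.

End geometric_time.

(** Nonnegativity of the variance of the absolute value. It serves to show that the coefficient of
    the minimum in the product moment is nonnegative. *)
Lemma sqr_expectation_norm_le d (T : measurableType d) (R : realType)
    (P : probability T R) (X : {RV P >-> R}) (m v : R) :
  ('E_P[fun w => `|X w|%R] = m%:E)%E ->
  ('E_P[fun w => (X w ^+ 2)%R] = v%:E)%E -> m ^+ 2 <= v.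
Proof.
move=> Xm Xv.
have mX : measurable_fun [set: T] (fun w => `|X w|) by exact: measurableT_comp.
have sqrE : ('E_P[fun w => (`|X w| ^+ 2)%R] = v%:E)%E.
  rewrite -Xv; congr expectation; apply/funext => w.
  by rewrite real_normK// num_real.
have X2 : (fun w => `|X w|) \in Lfun P 2%:E.
  by apply: Lfun2_expectation_sqr => //; rewrite sqrE ltry.
have := variance_ge0 P (fun w => `|X w|); rewrite varianceE// Xm.
rewrite [X in ('E_P[X] - _)%E](_ : _ = (fun w => `|X w| ^+ 2)); last first.
  by apply/funext => w; rewrite !expr2.
by rewrite sqrE -EFin_expe -EFinB lee_fin subr_ge0.
Qed.

Theorem theorem1 (d : measure_display) (T : measurableType d) (R : realType)
  (P : probability T R)
  (b : R) (nu : {measure set R -> \bar R}) (lambda mu : R)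
  (N D G Nf Nfmu : R -> {RV P >-> R})
  (b_ge0 : 0 <= b) (nu_levy : infinite_levy_measure nu)
  (lambda_gt0 : 0 < lambda) (mu_gt0 : 0 < mu)
  (D_subordinator : subordinator (bernstein_fun b nu) D)
  (N_poisson : poisson_process lambda N)
  (N_D_independent : independent_processes N D)
  (NfE : time_change N D Nf)
  (G_geometric : geometric_counting_process mu G)
  (G_Nf_independent : independent_processes G Nf)
  (NfmuE : forall t : R, 0 <= t ->
     {ae P, forall w, Nfmu t w = N (D (G t w) w) w})
  (Nf_moments : forall r t : R, 0 < r -> 0 <= t ->
     ('E_P[fun w => (Nf t w `^ r)%R] < +oo)%E) :
  [/\ forall t : R, 0 <= t ->
        ('E_P[Nfmu t] = (lambda * mu * t)%:E * 'E_P[D 1%R])%E,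
      forall t : R, 0 <= t ->
        ('V_P[Nfmu t] =
          (lambda * mu * t)%:E *
            (lambda%:E * 'E_P[fun w => (D 1 w ^+ 2)%R] + 'E_P[D 1%R]) +
          (mu ^+ 2 * lambda ^+ 2 * t ^+ 2)%:E * 'E_P[D 1%R] ^+ 2)%E
    & forall s t : R, 0 < s -> s < t ->
        (covariance P (Nfmu t) (Nfmu s) =
          (lambda * mu * s)%:E *
            (lambda%:E * 'E_P[fun w => (D 1 w ^+ 2)%R] + 'E_P[D 1%R]) +
          (mu ^+ 2 * lambda ^+ 2 * s * t)%:E * 'E_P[D 1%R] ^+ 2)%E].
Proof.
have Nf_ge0 t : 0 <= t -> {ae P, forall w, 0 <= Nf t w}.
  exact: (subordinated_poisson_ge0 lambda_gt0 N_poisson D_subordinator NfE).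
have D2fin : ('E_P[fun w => (D 1 w ^+ 2)%R] < +oo)%E.
  apply: (subordinator_sqr_fin lambda_gt0 N_poisson D_subordinator
    N_D_independent NfE).
  (* The real power agrees with the square on nonnegative values, hence almost surely here. *)
  apply: le_lt_trans (Nf_moments 2 1 (ltr0n _ 2) ler01).
  rewrite le_eqVlt; apply/orP; left; apply/eqP; apply: ae_eq_expectation.
  - exact: measurable_funX.
  - exact: (measurableT_comp (measurable_powR _)).
  - by apply: filterS (Nf_ge0 _ ler01) => w Nf0; rewrite powR_mulrn.
have D2E : ('E_P[fun w => (D 1 w ^+ 2)%R] \is a fin_num)%E.
  by rewrite ge0_fin_numE// expectation_ge0// => w; exact: sqr_ge0.
have Dv := esym (fineK D2E); set v := fine _ in Dv.
have D1 : (D 1 : T -> R) \in Lfun P 1 by exact: Lfun1_expectation_sqr.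
have DnormE : 'E_P[D 1%R]%E = 'E_P[fun w => `|D 1 w|%R]%E.
  have [[D0 _ _ _] D_nd _] := D_subordinator.
  apply: ae_eq_expectation => //; first exact: measurableT_comp.
  apply: filterS2 D0 D_nd => w D0w Dw.
  by have := Dw _ _ (lexx 0) ler01; rewrite D0w => D1w; rewrite ger0_norm.
have Dm := esym (fineK (expectation_fin_num D1)); set m := fine _ in Dm.
have Dm' : 'E_P[fun w => `|D 1 w|%R]%E = m%:E by rewrite -DnormE.
have m0 : 0 <= m by rewrite -lee_fin -Dm' expectation_ge0.
have mv := sqr_expectation_norm_le Dm' Dv.
(* Chosen so that [a + (lambda * m) ^ 2 = lambda * (lambda * v + m)], the first coefficient in the
   variance and covariance. *)
pose a := lambda ^+ 2 * (v - m ^+ 2) + lambda * m.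
have a0 : 0 <= a.
  by rewrite addr_ge0// mulr_ge0 ?sqr_ge0 ?subr_ge0// ltW.
have c0 : 0 <= lambda * m by rewrite mulr_ge0// ltW.
have X_ge0 n : {ae P, forall w, 0 <= Nf n%:R w} by exact: Nf_ge0.
have X_mean := expectation_norm_subordinated_poisson lambda_gt0 N_poisson
  D_subordinator N_D_independent NfE Dm'.
have X_prod j k : ('E_P[fun w => `|Nf j%:R w * Nf k%:R w|%R] =
    (a * Num.min j%:R k%:R + (lambda * m) ^+ 2 * j%:R * k%:R)%:E)%E.
  rewrite exprMn.
  exact: (expectation_norm_mul_subordinated_poisson lambda_gt0 N_poisson
    D_subordinator N_D_independent NfE Dm' Dv).
(* Each [Nf t] equals [N (D t)] off a null set that depends on [t]. At natural times these sets are
   countably many, so one null set allows [Nf] to be evaluated at the value of the clock. *)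
have ZX t : 0 <= t ->
    {ae P, forall w, forall n : nat, G t w = n%:R -> Nfmu t w = Nf n%:R w}.
  move=> t0; have Nfmut := NfmuE t t0.
  have Nfn : {ae P, forall w, forall n : nat, Nf n%:R w = N (D n%:R w) w}.
    by apply: ae_foralln => n; exact: NfE.
  by apply: filterS2 Nfmut Nfn => w -> Nfw n ->.
have mean := expectation_geometric_time mu_gt0 G_geometric G_Nf_independent
  ZX X_ge0 X_mean c0.
have cov := covariance_geometric_time mu_gt0 G_geometric G_Nf_independent
  ZX X_ge0 X_mean X_prod a0 c0.
split.
- move=> t t0; rewrite mean// Dm -EFinM; congr EFin; ring.
- move=> t t0; rewrite /variance cov// Dv Dm -EFin_expe -!(EFinM, EFinD).
  by congr EFin; rewrite /a; ring.
- move=> s t s0 st; rewrite cov ?ltW// Dv Dm -EFin_expe -!(EFinM, EFinD).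
  by congr EFin; rewrite /a; ring.
Qed.
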